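(* Let $(X_n)_{n\ge0}$ be a transient nearest neighbour random walk on the directed cover $\mathcal{T}$ of $G$ with transition data $p_G(i,j)$, $p(-i)$, whose non-zero transition probabilities are bounded away from $0$: there is $\varepsilon_0>0$ with $p(x,y)\ge\varepsilon_0$ for all $x,y\in\mathcal{T}$ with $p(x,y)>0$. Assume that the Markov chain on $G$ with transition matrix $Q=(q(i,j))_{i,j\in G}$, $q(i,j)=\frac{1-F(-j)}{1-F(-i)}\,p(i,j)\,\overline{G}_i(1)$, is positive recurrent, and that the spectral radius of $(X_n)$ is strictly smaller than $1$. Let $\pi_n$ be the distribution of $X_n$ and $h=\lim_{n\to\infty}-\frac1n\mathbb{E}[\log\pi_n(X_n)]$ the asymptotic entropy (which exists). Then $-\frac1n\log\pi_n(X_n)\to h$ in $L_1$ as $n\to\infty$, that is, $$\int\Bigl|-\frac1n\log\pi_n(X_n)-h\Bigr|\,d\mathbb{P}\to0\quad\text{for } n\to\infty.$$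
   Context: $G$ is a countable directed graph, strongly connected, of bounded geometry (uniformly bounded vertex degrees), without multiple edges; $i_0\in G$. The directed cover $\mathcal{T}$ of $G$ rooted in $i_0$ is the rooted tree with vertices labelled by $\tau:\mathcal{T}\to G$: the root $o$ has label $i_0$, and recursively a vertex with label $i$ has exactly one direct descendant with label $j$ for each edge $(i,j)$ of $G$ and no others. $x^-$ denotes the direct ancestor of $x\neq o$. Given are transition probabilities $p_G(i,j)$ on $G$ (stochastic, with $p_G(i,j)>0$ iff there is an edge from $i$ to $j$) and backward probabilities $p(-i)\in(0,1)$, $i\in G$, such that for some $\varepsilon\in(0,1)$, $\varepsilon<p(-i)<1-\varepsilon$ for all $i$. Put $p(i,j)=(1-p(-i))p_G(i,j)$. A loop is added at the root. The random walk $(X_n)$ on $\mathcal{T}$ starts at $o$ and has transition probabilities $p(x,y)=p(\tau(x),\tau(y))$ if $y^-=x$; $p(x,x^-)=p(-\tau(x))$ for $x\ne o$; $p(o,o)=p(-i_0)$; and $0$ otherwise. For $i\in G$ and any $x\in\mathcal{T}\setminus\{o\}$ with $\tau(x)=i$ (the choice is irrelevant), $F(-i)=\mathbb{P}[\exists n:\ X_n=x^-\mid X_0=x]$ and $\overline{G}_i(1)=\sum_{n\ge0}\mathbb{P}[X_n=x,\ X_m\neq x^-\ \forall m<n\mid X_0=x]$. The spectral radius of $(X_n)$ is $1/R$, where $R$ is the radius of convergence of $G(o,o|z)=\sum_{n\ge0}\mathbb{P}[X_n=o\mid X_0=o]z^n$. *)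

(* Defs.v *)
From mathcomp Require Import all_boot all_order all_algebra.
From mathcomp Require Import all_classical all_reals all_analysis.
Set Implicit Arguments.
Unset Strict Implicit.
Unset Printing Implicit Defensive.
Import Order.TTheory GRing.Theory Num.Theory.
Import numFieldNormedType.Exports.
Local Open Scope classical_set_scope.
Local Open Scope ring_scope.

(* A directed graph without multiple edges is an edge relation; loops are
   allowed. *)

Definition strongly_connected (G : countType) (E : rel G) : Prop :=
  forall i j : G, exists s : seq G, path E i s /\ last i s = j.

(* The degree that matters for the directed cover is the out-degree. *)
Definition bounded_geometry (G : countType) (E : rel G) : Prop :=
  exists D : nat, forall i : G, ([set j | E i j] #<= `I_D)%card.

(* The vertex of the cover reached from the root through the labels
   i1, ..., in is encoded as the path [:: i1; ...; in] of E starting at i0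
   (with i0 itself omitted); the root is the empty path. *)
Definition dcover (G : countType) (E : rel G) (i0 : G) : Type :=
  {s : seq G | path E i0 s}.

Definition cover_root (G : countType) (E : rel G) (i0 : G) : dcover E i0 :=
  exist _ [::] isT.

Arguments cover_root {G E i0}.

Definition label (G : countType) (E : rel G) (i0 : G) (x : dcover E i0) : G :=
  last i0 (val x).

Lemma parent_subproof (G : countType) (E : rel G) (i0 : G)
  (x : dcover E i0) : path E i0 (take (size (val x)).-1 (val x)).
Proof. exact/take_path/(valP x). Qed.

(* Junk value: [parent cover_root = cover_root]. *)
Definition parent (G : countType) (E : rel G) (i0 : G) (x : dcover E i0) :
  dcover E i0 :=
  exist (fun s => path E i0 s) _ (parent_subproof x).

Lemma dcover_descendant (G : countType) (E : rel G) (i0 : G)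
  (x : dcover E i0) (j : G) : E (label x) j ->
  exists! y : dcover E i0, [/\ y <> cover_root, parent y = x & label y = j].
Proof.
move=> Exj; have px : path E i0 (rcons (val x) j).
  by rewrite rcons_path (valP x).
exists (exist (fun s => path E i0 s) _ px); split.
  split=> [/(congr1 val)||] /=.
  - by move/(congr1 size); rewrite size_rcons.
  - by apply: val_inj => /=; rewrite size_rcons /= -cats1 take_size_cat.
  - by rewrite /label /= last_rcons.
move=> [s ps] [s0 parx labj]; apply: val_inj => /=; rewrite -labj -parx /=.
case/lastP: s ps s0 {parx labj} => [ps []|s k ps _]; first exact: val_inj.
rewrite /label /= last_rcons size_rcons /=.
by congr rcons; rewrite -cats1 take_size_cat.
Qed.

Lemma dcover_edge (G : countType) (E : rel G) (i0 : G) (y : dcover E i0) :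
  y <> cover_root -> E (label (parent y)) (label y).
Proof.
case: y => s; case/lastP: s => [ps []|s k ps _]; first exact: val_inj.
have := ps; rewrite [X in is_true X -> _]rcons_path => /andP[_].
by rewrite /label /= last_rcons size_rcons /= -cats1 take_size_cat.
Qed.

(* [b i] stands for the backward probability p(-i). *)
Definition forward_prob (R : realType) (G : countType)
  (pG : G -> G -> R) (b : G -> R) (i j : G) : R := (1 - b i) * pG i j.

Definition cover_prob (R : realType) (G : countType) (E : rel G) (i0 : G)
  (pG : G -> G -> R) (b : G -> R) (x y : dcover E i0) : R :=
  if (y != cover_root) && (parent y == x) then forward_prob pG b (label x) (label y)
  else if (x != cover_root) && (y == parent x) then b (label x)
  else if (x == cover_root) && (y == cover_root) then b i0
  else 0.

Definition transition_data (R : realType) (G : countType) (E : rel G)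
  (pG : G -> G -> R) (b : G -> R) : Prop :=
  [/\ forall i j : G, 0 <= pG i j,
      forall i : G, (\esum_(j in [set: G]) (pG i j)%:E = 1)%E,
      forall i j : G, 0 < pG i j <-> E i j &
      exists eps : R, 0 < eps < 1 /\ forall i : G, eps < b i < 1 - eps].

(* [P x] is the law of the chain (X_n) started at x, that is,
   P[ . | X_0 = x]. *)
Definition markov_chain (R : realType) (S : countType) (p : S -> S -> R)
  (d : measure_display) (W : measurableType d) (P : S -> probability W R)
  (X : nat -> W -> S) : Prop :=
  [/\ forall (n : nat) (x : S), measurable [set w | X n w = x],
      forall x : S, P x [set w | X 0%N w = x] = 1%E &
      forall (x : S) (n : nat) (s : nat -> S),
        P x [set w | forall k, (k <= n.+1)%N -> X k w = s k] =
        (P x [set w | forall k, (k <= n)%N -> X k w = s k] *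
         (p (s n) (s n.+1))%:E)%E].

Definition transient (R : realType) (S : countType) (d : measure_display)
  (W : measurableType d) (P : S -> probability W R) (X : nat -> W -> S) :
  Prop :=
  forall x : S, (P x [set w | exists n, (0 < n)%N /\ X n w = x] < 1)%E.

(* Equal to +oo when the chain never returns. *)
Definition return_time (R : realType) (S : countType) (W : Type)
  (X : nat -> W -> S) (x : S) (w : W) : \bar R :=
  ereal_inf [set (n%:R)%:E | n in [set n | (0 < n)%N /\ X n w = x]].

(* The chain with transition matrix q is positive recurrent; which of its
   realizations is used is irrelevant. *)
Definition positive_recurrent (R : realType) (S : countType)
  (q : S -> S -> R) : Prop :=
  exists (d : measure_display) (W : measurableType d)
    (P : S -> probability W R) (X : nat -> W -> S),
    markov_chain q P X /\
    forall x : S, (\int[P x]_w return_time R X x w < +oo)%E.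

(* Some x <> cover_root with label i; one exists when E is strongly connected and
   every vertex has a successor. *)
Definition vertex_of (G : countType) (E : rel G) (i0 : G) (i : G) :
  dcover E i0 := xget cover_root [set x | x <> cover_root /\ label x = i].

Definition F_back (R : realType) (G : countType) (E : rel G) (i0 : G)
  (d : measure_display) (W : measurableType d)
  (P : dcover E i0 -> probability W R) (X : nat -> W -> dcover E i0)
  (i : G) : R :=
  let x := vertex_of E i0 i in
  fine (P x [set w | exists n, X n w = parent x]).

Definition G_bar (R : realType) (G : countType) (E : rel G) (i0 : G)
  (d : measure_display) (W : measurableType d)
  (P : dcover E i0 -> probability W R) (X : nat -> W -> dcover E i0)
  (i : G) : R :=
  let x := vertex_of E i0 i in
  fine (\sum_(0 <= n <oo)
    P x [set w | X n w = x /\ forall m, (m < n)%N -> X m w <> parent x])%E.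

Definition Q_matrix (R : realType) (G : countType) (E : rel G) (i0 : G)
  (pG : G -> G -> R) (b : G -> R) (d : measure_display)
  (W : measurableType d) (P : dcover E i0 -> probability W R)
  (X : nat -> W -> dcover E i0) (i j : G) : R :=
  (1 - F_back P X j) / (1 - F_back P X i) * forward_prob pG b i j *
  G_bar P X i.

(* [law P X x n y] is P[X_n = y | X_0 = x]. *)
Definition law (R : realType) (S : countType) (d : measure_display)
  (W : measurableType d) (P : S -> probability W R) (X : nat -> W -> S)
  (x : S) (n : nat) (y : S) : R := fine (P x [set w | X n w = y]).

Definition convergence_radius (R : realType) (a : nat -> R) : \bar R :=
  ereal_sup [set z%:E | z in
    [set z : R | 0 <= z /\ cvgn (series (fun n => a n * z ^+ n))]].

Definition spectral_radius (R : realType) (G : countType) (E : rel G)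
  (i0 : G) (d : measure_display) (W : measurableType d)
  (P : dcover E i0 -> probability W R) (X : nat -> W -> dcover E i0) :
  \bar R :=
  ((convergence_radius (fun n => law P X cover_root n cover_root))^-1)%E.

(* Main.v *)
(* A vertex of the cover is a stack of labels, and the walk pushes and pops.
   Decomposing at last pushes, the Green function G(o, x) factorizes along the
   labels of x, so that -log G(o, x) is, up to a constant, a sum A(x) of bounded
   costs over the edges from o to x.

   1. Since pi_n(x) <= G(o, x), and since (by rho < 1) at least half of G(o, x)
      is contributed by times linear in n, uniformly over |x| <= n, Gibbs'
      inequality against the time-averaged laws shows that -log pi_n(X_n) and
      A(X_n) differ by O(log n) in L1. It remains to prove that A(X_n) / n
      converges in L1.
   2. The label of the vertex at which the walk finally leaves level k is a
      Q-chain, and given the labels the waiting times between the final exits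
      are independent with uniformly geometric tails (supermultiplicativity of
      the loop probabilities turns the decay at the root into a bound that does
      not depend on the label). A law of large numbers in L1 holds for additive
      functionals of the Q-chain: the Poisson equation is solved up to a small
      error by the potential of the chain killed at i0 after finitely many steps,
      and positive recurrence makes the error small.
   3. A is Lipschitz, so A(X_n) is compared with its value at the final exit from
      level k ~ n / theta, where theta is the mean waiting time; the last push
      before time n onto level k has, up to a small mass, the law of the final
      one. *)

(* Two obstacles shape the argument. The label set is infinite, so no compactness yields uniform
   constants; and positive recurrence gives only a first moment for the return time to [i0], so
   excursions cannot be squared. Hence the truncated potential: its error is a tail of the
   convergent series of [avoid_mass], and only martingale increments that are bounded get squared.

   A single recursion serves two walks: [stack_law] with [lam = b i0] is the walk on the whole
   cover, with [lam = 0] the walk in the cone above a vertex, killed on leaving it. A cone depends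
   only on the label of its apex, so cutting at last pushes produces convolutions, along which means
   and variances add up. Final exits are not stopping times; they are handled by weighting a push
   with the escape probability of the pushed label.

   At time [n] the height is at most [n], so expectations are finite sums over [stacks]; probability
   spaces enter only when hypotheses and conclusion are translated. The limit [h] is the mean cost
   per level divided by [theta]. The expectations converge to the same [h], a signed mean error
   being dominated by the mean absolute error. *)
Require Import Defs.
From mathcomp Require Import all_boot all_order all_algebra.
From mathcomp Require Import all_classical all_reals all_analysis.
From mathcomp Require Import measurable_realfun.
From mathcomp Require Import ring lra zify.
Set Implicit Arguments.
Unset Strict Implicit.
Unset Printing Implicit Defensive.
Import Order.TTheory GRing.Theory Num.Theory.
Import numFieldNormedType.Exports.
Local Open Scope classical_set_scope.
Local Open Scope ring_scope.

(** * Convolution and moments of summable sequences *)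

Section Sequences.
Variable R : realType.
Implicit Types (f g : nat -> R) (s t c v : R).

Definition sums_to f s := series f @ \oo --> s.

Definition conv f g (n : nat) : R := \sum_(i < n.+1) f i * g (n - i)%N.

Definition shift f (n : nat) : R := if n is m.+1 then f m else 0.

Lemma series_ordE f n : series f n = \sum_(k < n) f k.
Proof. by rewrite seriesEord. Qed.

Lemma sums_to_ext f g s : f =1 g -> sums_to f s -> sums_to g s.
Proof. by move=> fg; rewrite /sums_to (_ : f = g) //; apply/funext. Qed.

Lemma sums_to_inj f s t : sums_to f s -> sums_to f t -> s = t.
Proof. by move=> fs ft; exact: (cvg_unique _ fs ft). Qed.

Lemma sums_toZ f s c : sums_to f s -> sums_to (fun n => c * f n) (c * s).
Proof.
move=> fs; rewrite /sums_to (_ : series _ = fun n => c * series f n).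
  exact: cvgMr.
by apply/funext => n; rewrite !seriesEnat /= mulr_sumr.
Qed.

Arguments sums_toZ {f s} c _.

Lemma sums_toD f g s t :
  sums_to f s -> sums_to g t -> sums_to (fun n => f n + g n) (s + t).
Proof.
move=> fs gt; rewrite /sums_to (_ : series _ = fun n => series f n + series g
  n).
  exact: cvgD.
by apply/funext => n; rewrite !seriesEnat /= big_split.
Qed.

Lemma sums_to_big (I : Type) (r : seq I) (f : I -> nat -> R) (s : I -> R) :
  (forall i, sums_to (f i) (s i)) ->
  sums_to (fun n => \sum_(i <- r) f i n) (\sum_(i <- r) s i).
Proof.
move=> fs; elim: r => [|i r IH].
  rewrite big_nil (_ : (fun _ => _) = fun=> 0); last first.
    by apply/funext => n; rewrite big_nil.
  rewrite /sums_to (_ : series _ = fun=> 0); first exact: cvg_cst.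
  by apply/funext => n; rewrite seriesEnat /= big1.
rewrite big_cons; apply: sums_to_ext (sums_toD (fs i) IH) => n.
by rewrite big_cons.
Qed.

Lemma sums_to_shift f s : sums_to f s -> sums_to (shift f) s.
Proof.
rewrite /sums_to -(cvg_shiftS (series (shift f))).
rewrite (_ : [sequence _]_n = series f) //; apply/funext => n /=.
by rewrite !series_ordE big_ord_recl /= add0r.
Qed.

Lemma sums_to_partial f s n : (forall k, 0 <= f k) -> sums_to f s ->
  \sum_(k < n) f k <= s.
Proof.
move=> f0 fs; have fcv : cvgn (series f) by apply/cvg_ex; exists s.
rewrite -(cvg_lim (@Rhausdorff R) fs).
rewrite -series_ordE; apply: nondecreasing_cvgn_le fcv n.
by apply/nondecreasing_seqP => k; rewrite seriesSr lerDl.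
Qed.

Lemma sums_to_ge0 f s : (forall k, 0 <= f k) -> sums_to f s -> 0 <= s.
Proof. by move=> f0 /(sums_to_partial 0 f0); rewrite big_ord0. Qed.

Lemma sums_to_le f s t :
  (forall n, \sum_(k < n) f k <= t) -> sums_to f s -> s <= t.
Proof.
move=> ft fs; have fcv : cvgn (series f) by apply/cvg_ex; exists s.
rewrite -(cvg_lim (@Rhausdorff R) fs); apply: limr_le => //.
by near=> n; rewrite series_ordE.
Unshelve. all: end_near. Qed.

Lemma sums_to_bounded f t : (forall k, 0 <= f k) ->
  (forall n, \sum_(k < n) f k <= t) -> exists s, sums_to f s.
Proof.
move=> f0 ft; exists (limn (series f)).
apply: nondecreasing_is_cvgn.
  by apply/nondecreasing_seqP => k; rewrite seriesSr lerDl.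
by exists t => _ [n _ <-]; rewrite series_ordE.
Qed.

Lemma sums_to_dominated f g t :
  (forall k, 0 <= f k) -> (forall k, f k <= g k) ->
  sums_to g t -> exists2 s, sums_to f s & s <= t.
Proof.
move=> f0 fg gt; have ft n : \sum_(k < n) f k <= t.
  have g0 k : 0 <= g k by exact: le_trans (fg k).
  by apply: le_trans (sums_to_partial n g0 gt); apply: ler_sum.
have [s fs] := sums_to_bounded f0 ft.
by exists s => //; exact: sums_to_le fs.
Qed.

Lemma sums_to_geometric (z : R) :
  1 < z -> sums_to (fun n => z^-1 ^+ n) (1 - z^-1)^-1.
Proof.
move=> z1; have z0 : 0 < z by exact: lt_trans z1.
have /cvg_geometric_series H : `|z^-1| < 1.
  by rewrite gtr0_norm ?invr_gt0 // invf_lt1.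
have := H 1; rewrite mul1r; apply: sums_to_ext => n.
by rewrite /geometric /= mul1r.
Qed.

Lemma conv_partial f g n : \sum_(k < n) conv f g k =
  \sum_(i < n) f i * \sum_(j < n - i) g j.
Proof.
elim: n => [|n IH]; first by rewrite !big_ord0.
rewrite big_ord_recr /= IH.
have -> : \sum_(i < n) f i * (\sum_(j < n - i) g j) =
          \sum_(i < n.+1) f i * (\sum_(j < n - i) g j).
  by rewrite big_ord_recr /= subnn big_ord0 mulr0 addr0.
rewrite /conv -big_split /=; apply: eq_bigr => i _.
by rewrite subSn ?big_ord_recr /= ?mulrDr // -ltnS.
Qed.

(** The triangular partial sums of the Cauchy product are squeezed between products of partial
    sums. *)
Lemma sums_to_conv f g s t : (forall k, 0 <= f k) -> (forall k, 0 <= g k) ->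
  sums_to f s -> sums_to g t -> sums_to (conv f g) (s * t).
Proof.
move=> f0 g0 fs gt.
have s0 := sums_to_ge0 f0 fs; have t0 := sums_to_ge0 g0 gt.
have c0 k : 0 <= conv f g k by apply: sumr_ge0 => i _; rewrite mulr_ge0.
have le1 n : \sum_(k < n) conv f g k <= s * t.
  rewrite conv_partial.
  apply: (@le_trans _ _ (\sum_(i < n) f i * t)).
    by apply: ler_sum => i _; rewrite ler_wpM2l //; exact: sums_to_partial.
  by rewrite -mulr_suml ler_wpM2r //; exact: sums_to_partial.
have [c hc] := sums_to_bounded c0 le1.
suff <- : c = s * t by [].
apply/eqP; rewrite eq_le (sums_to_le le1 hc) /=.
(* The square of indices [i, j < n] lies in the triangle [i + j < n + n]. *)
have le2 n : series f n * series g n <= c.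
  apply: le_trans (sums_to_partial (n + n) c0 hc).
  rewrite conv_partial !series_ordE big_split_ord /=.
  rewrite -[X in X <= _]addr0; apply: lerD; last first.
    by apply: sumr_ge0 => i _; rewrite mulr_ge0 // sumr_ge0.
  rewrite mulr_suml; apply: ler_sum => i _; rewrite ler_wpM2l //.
  have -> : (n + n - i = n + (n - i))%N by rewrite addnBA // ltnW.
  by rewrite big_split_ord /= lerDl sumr_ge0.
have cv : (fun n => series f n * series g n) @ \oo --> s * t by exact: cvgM.
have cvx : cvgn (fun n => series f n * series g n) := cvgP _ cv.
rewrite -(cvg_lim (@Rhausdorff R) cv); apply: limr_le cvx _.
exact: nearW.
Qed.

(* [c] and [v] are the mean and variance of the normalized weights. *)
Definition has_moments f s c v :=
  [/\ sums_to f s, sums_to (fun n => n%:R * f n) (c * s)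
    & sums_to (fun n => n%:R ^+ 2 * f n) ((v + c ^+ 2) * s)].

Lemma has_momentsZ f s c v (a : R) : has_moments f s c v ->
  has_moments (fun n => a * f n) (a * s) c v.
Proof.
move=> [h0 h1 h2]; split; first exact: sums_toZ.
  rewrite (_ : c * (a * s) = a * (c * s)); last by ring.
  by apply: sums_to_ext (sums_toZ a h1) => n; ring.
rewrite (_ : _ * (a * s) = a * ((v + c ^+ 2) * s)); last by ring.
by apply: sums_to_ext (sums_toZ a h2) => n; ring.
Qed.

Lemma has_moments_shift f s c v :
  has_moments f s c v -> has_moments (shift f) s (c + 1) v.
Proof.
move=> [h0 h1 h2]; split; first exact: sums_to_shift.
  rewrite mulrDl mul1r.
  apply: sums_to_ext (sums_to_shift (sums_toD h1 h0)) => -[|n] /=;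
    first by rewrite mul0r.
  by rewrite -natr1; ring.
rewrite (_ : _ * s = (v + c ^+ 2) * s + (2 * (c * s) + s)); last by ring.
apply: sums_to_ext (sums_to_shift (sums_toD h2 (sums_toD (sums_toZ 2 h1) h0)))
  => -[|n] /=.
  by rewrite expr0n mul0r.
by rewrite -natr1; ring.
Qed.

(** Sums of independent times: expand [n = i + (n - i)] and its square under the convolution. *)
Lemma has_moments_conv f g s t c c' v v' :
  (forall k, 0 <= f k) -> (forall k, 0 <= g k) ->
  has_moments f s c v -> has_moments g t c' v' ->
  has_moments (conv f g) (s * t) (c + c') (v + v').
Proof.
move=> f0 g0 [h0 h1 h2] [k0 k1 k2].
have f10 k : 0 <= k%:R * f k by rewrite mulr_ge0.
have g10 k : 0 <= k%:R * g k by rewrite mulr_ge0.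
have f20 k : 0 <= k%:R ^+ 2 * f k by rewrite mulr_ge0 // exprn_ge0.
have g20 k : 0 <= k%:R ^+ 2 * g k by rewrite mulr_ge0 // exprn_ge0.
split; first exact: sums_to_conv.
  rewrite (_ : _ * _ = c * s * t + s * (c' * t)); last by ring.
  apply: sums_to_ext (sums_toD (sums_to_conv f10 g0 h1 k0) (sums_to_conv f0 g10
    h0 k1)) => n.
  rewrite /conv -big_split mulr_sumr; apply: eq_bigr => i _ /=.
  have -> : n%:R = i%:R + (n - i)%:R :> R by rewrite -natrD subnKC // -ltnS.
  by ring.
rewrite (_ : _ * _ = (v + c ^+ 2) * s * t + (2 * (c * s * (c' * t)) +
  s * ((v' + c' ^+ 2) * t))); last by ring.
apply: sums_to_ext (sums_toD (sums_to_conv f20 g0 h2 k0) (sums_toD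
  (sums_toZ 2 (sums_to_conv f10 g10 h1 k1)) (sums_to_conv f0 g20 h0 k2))) => n.
rewrite /conv mulr_sumr -!big_split mulr_sumr; apply: eq_bigr => i _ /=.
have -> : n%:R = i%:R + (n - i)%:R :> R by rewrite -natrD subnKC // -ltnS.
by ring.
Qed.

(** Chebyshev's bound in the form [x <= x ^ 2 / (2 a) + a / 2]; the free parameter [a] spares a
    square root and is later taken of the order of the allowed deviation. *)
Lemma has_moments_absdev f s c v (a : R) n : (forall k, 0 <= f k) -> 0 < a ->
  has_moments f s c v -> \sum_(k < n) f k * `|k%:R - c| <=
    s * ((v / a + a) / 2).
Proof.
move=> f0 a0 [h0 h1 h2].
have hv : sums_to (fun k => f k * (k%:R - c) ^+ 2) (s * v).
  rewrite (_ : s * v = (v + c ^+ 2) * s + ((- 2 * c) * (c * s) + c ^+ 2 * s));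
    last by ring.
  apply: sums_to_ext (sums_toD h2 (sums_toD (sums_toZ (- 2 * c) h1) (sums_toZ
    (c ^+ 2) h0))) => k.
  by ring.
apply: (@le_trans _ _ (\sum_(k < n) (f k * (k%:R - c) ^+ 2 * (2 * a)^-1
    + f k * (a / 2)))).
  apply: ler_sum => k _; rewrite -mulrA -mulrDr ler_wpM2l //.
  rewrite -[X in X * _]ger0_norm ?sqr_ge0 // normrX.
  set x := `|_|.
  have : 0 <= (x - a) ^+ 2 / (2 * a) by rewrite divr_ge0 ?sqr_ge0 // mulr_ge0
    // ltW.
  suff -> : (x - a) ^+ 2 / (2 * a) = x ^+ 2 / (2 * a) + a / 2 - x by rewrite
    subr_ge0.
  by field; rewrite gt_eqF.
rewrite big_split /= -!mulr_suml.
rewrite (_ : s * _ = s * v * (2 * a)^-1 + s * (a / 2)); last by field;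
  rewrite gt_eqF.
have a0' := ltW a0.
apply: lerD; rewrite ler_wpM2r ?invr_ge0 ?divr_ge0 ?mulr_ge0 //.
  by apply: (sums_to_partial _ _ hv) => k; rewrite mulr_ge0 ?sqr_ge0.
exact: sums_to_partial h0.
Qed.

End Sequences.

Arguments sums_toZ {R f s} c _.

(** * Linearity of convolution, and sums over lists *)

Section ConvLinear.
Variable R : realType.
Implicit Types f g : nat -> R.

Lemma conv_recr f g n :
  conv f g n = f n * g 0%N + shift (conv f (fun t => g t.+1)) n.
Proof.
case: n => [|n]; first by rewrite /conv big_ord1 /= addr0.
rewrite /conv big_ord_recr /= subnn addrC; congr (_ + _).
by apply: eq_bigr => i _; rewrite subSn // -ltnS.
Qed.

Lemma eq_shift f g n : f =1 g -> shift f n = shift g n.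
Proof. by move=> fg; case: n => /=. Qed.

(** The second argument of [conv] has the shape of the recursion defining [stack_law]: one push and
    a sum of pops. *)
Lemma shift_conv_linear (I : Type) (r : seq I) (h : I -> nat -> R) (c : I -> R)
    (x : R) f g n :
  shift (conv f (fun t => g t * x + \sum_(k <- r) h k t * c k)) n =
  shift (conv f g) n * x + \sum_(k <- r) shift (conv f (h k)) n * c k.
Proof.
case: n => [|n] /=; first by rewrite mul0r big1 ?addr0 // => k _; rewrite mul0r.
rewrite /conv; under [X in _ = _ + X]eq_bigr do rewrite mulr_suml.
rewrite exchange_big /= mulr_suml -big_split /=; apply: eq_bigr => i _.
rewrite mulrDr mulrA; congr (_ + _); rewrite mulr_sumr.
by apply: eq_bigr => k _; rewrite mulrA.
Qed.

Lemma sum_ge_mem (I : eqType) (r : seq I) (F : I -> R) i :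
  (forall j, 0 <= F j) -> i \in r -> F i <= \sum_(j <- r) F j.
Proof.
move=> F0; elim: r => // j r IH; rewrite inE big_cons => /orP[/eqP <-|/IH h].
  by rewrite lerDl sumr_ge0.
by apply: le_trans h _; rewrite lerDr.
Qed.

Lemma sum_gt0_mem (I : eqType) (r : seq I) (F : I -> R) :
  (forall j, 0 <= F j) -> 0 < \sum_(j <- r) F j -> exists2 j, j \in r & 0 < F j.
Proof.
move=> F0; elim: r => [|j r IH]; first by rewrite big_nil ltxx.
rewrite big_cons; have := F0 j; rewrite le_eqVlt => /orP[/eqP <-|]; last first.
  by exists j => //; rewrite mem_head.
by rewrite add0r => /IH [k kr Fk]; exists k => //; rewrite inE kr orbT.
Qed.

End ConvLinear.

(** * Walks on stacks of labels *)

Section Stacks.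
Variables (R : realType) (G : eqType).
Variables (nbr : G -> seq G) (p : G -> G -> R) (b : G -> R).
Implicit Types (lam : R) (i j k : G) (l y : seq G).

(* [l] lists the labels above the bottom label [i], top first; [lam] is the
   probability of the loop at the bottom, [0] for a walk killed when it pops
     [i]. *)
Fixpoint stack_law lam i (n : nat) (l : seq G) : R :=
  if n is n'.+1 then
    if l is j :: l' then
      stack_law lam i n' l' * p (head i l') j + \sum_(k <- nbr j) stack_law lam
        i n' (k :: l) * b k
    else lam * stack_law lam i n' [::] + \sum_(k <- nbr i) stack_law lam i n'
      [:: k] * b k
  else (l == [::])%:R.

Definition loop_law i n := stack_law 0 i n [::].

Fixpoint stacks i (d : nat) : seq (seq G) :=
  if d is d'.+1 then [seq k :: l | l <- stacks i d',
    k <- nbr (head i l)] else [:: [::]].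

Fixpoint is_stack i l : bool :=
  if l is k :: l' then (k \in nbr (head i l')) && is_stack i l' else true.

Lemma mem_stacks i d l : (l \in stacks i d) = (size l == d) && is_stack i l.
Proof.
elim: d l => [|d IH] l /=; first by rewrite inE; case: l.
case: l => [|k l] /=; first by apply/allpairsPdep => -[? [? []]].
apply/allpairsPdep/idP => [[l' [k' [hl hk [-> ->]]]]|].
  by move: hl; rewrite IH hk eqSS => /andP[-> ->].
rewrite eqSS => /and3P[sl hk okl]; exists l, k; split => //.
by rewrite IH sl.
Qed.

Lemma sum_stacksS i d (F : seq G -> R) : \sum_(l <- stacks i d.+1) F l =
  \sum_(l <- stacks i d) \sum_(k <- nbr (head i l)) F (k :: l).
Proof. by rewrite /= big_allpairs_dep. Qed.

Lemma sum_stacks0 i (F : seq G -> R) : \sum_(l <- stacks i 0) F l = F [::].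
Proof. exact: big_seq1. Qed.

Lemma sum_stacks_cat i d e (F : seq G -> R) : \sum_(l <- stacks i (d + e)) F l =
  \sum_(v <- stacks i d) \sum_(y <- stacks (head i v) e) F (y ++ v).
Proof.
elim: e F => [|e IH] F.
  by rewrite addn0; apply: eq_bigr => v _; rewrite big_seq1.
rewrite addnS sum_stacksS IH; apply: eq_bigr => v _; rewrite sum_stacksS.
by apply: eq_bigr => y _; case: y.
Qed.

Lemma is_stack_cat i y l :
  is_stack i (y ++ l) = is_stack (head i l) y && is_stack i l.
Proof.
elim: y => //= k y ->; rewrite andbA; congr (_ && _ && _).
by case: y.
Qed.

Hypothesis uniq_nbr : forall i, uniq (nbr i).

Lemma uniq_stacks i d : uniq (stacks i d).
Proof.
elim: d => //= d IH; apply: allpairs_uniq_dep => //.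
by move=> [l1 k1] [l2 k2] _ _ /= [-> ->].
Qed.

Arguments stacks : simpl never.

Hypothesis p_ge0 : forall i j, 0 <= p i j.
Hypothesis b_ge0 : forall i, 0 <= b i.

Lemma stack_law_ge0 lam i n l : 0 <= lam -> 0 <= stack_law lam i n l.
Proof.
move=> lam0; elim: n l => [|n IH] l /=; first by rewrite ler0n.
by case: l => [|j l]; rewrite addr_ge0 ?mulr_ge0 // sumr_ge0 // => k _;
  rewrite mulr_ge0.
Qed.

Lemma loop_law_ge0 i n : 0 <= loop_law i n. Proof. exact: stack_law_ge0. Qed.

Lemma stack_law_size lam i n l : (n < size l)%N -> stack_law lam i n l = 0.
Proof.
elim: n l => [|n IH] [|j l] //= nl; rewrite IH // mul0r add0r big1 // => k _.
by rewrite IH ?mul0r //=; lia.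
Qed.

(* Decomposition at the last push of [j] onto [l] before time [n]. *)
Lemma stack_law_cat lam i n y j l : stack_law lam i n (y ++ j :: l) =
  p (head i l) j * shift (conv (fun r => stack_law lam i r l) (fun t =>
    stack_law 0 j t y)) n.
Proof.
elim: n y => [|n IH] y /=; first by rewrite mulr0; case: y.
case: y => [|k y] /=.
  under eq_bigr => k _ do rewrite (IH [:: k]).
  rewrite conv_recr /= mulr1 mulrDr [stack_law _ _ _ _ * _]mulrC; congr (_ + _).
  rewrite (@eq_shift _ _ (conv (fun r => stack_law lam i r l) (fun t =>
    stack_law 0 j t [::] * 0 + \sum_(k <- nbr j) stack_law 0 j t [:: k] * b
      k))); last first.
    by move=> t; congr conv; apply/funext => r; rewrite mulrC.
  rewrite shift_conv_linear mulr0 add0r mulr_sumr.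
  by apply: eq_bigr => k _; rewrite mulrA.
have -> : head i (y ++ j :: l) = head j y by case: y.
under eq_bigr => m _ do rewrite (IH (m :: k :: y)).
rewrite IH conv_recr /= mulr0 add0r shift_conv_linear mulrDr mulrA mulr_sumr.
by congr (_ + _); apply: eq_bigr => m _; rewrite mulrA.
Qed.

(** A walk back at the bottom at time [r] starts afresh. The induction is on [n], because the
    recursion peels off the last step. *)
Lemma stack_law_supermul lam i r n l : 0 <= lam ->
  stack_law lam i r [::] * stack_law lam i n l <= stack_law lam i (r + n) l.
Proof.
move=> lam0; elim: n l => [|n IH] l.
  rewrite addn0 /=; case: l => [|j l] /=; first by rewrite mulr1.
  by rewrite mulr0 stack_law_ge0.
rewrite addnS /=; case: l => [|j l]; rewrite mulrDr; apply: lerD.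
- by rewrite mulrCA ler_wpM2l.
- rewrite mulr_sumr; apply: ler_sum => k _.
  by rewrite mulrA ler_wpM2r.
- by rewrite mulrA ler_wpM2r.
- by rewrite mulr_sumr; apply: ler_sum => k _; rewrite mulrA ler_wpM2r.
Qed.

Lemma stack_law_push lam i n j l : 0 <= lam ->
  stack_law lam i n l * p (head i l) j <= stack_law lam i n.+1 (j :: l).
Proof.
by move=> lam0; rewrite /= lerDl sumr_ge0 // => k _;
  rewrite mulr_ge0 ?stack_law_ge0.
Qed.

Lemma stack_law_pop lam i n k l : 0 <= lam -> k \in nbr (head i l) ->
  stack_law lam i n (k :: l) * b k <= stack_law lam i n.+1 l.
Proof.
move=> lam0 kl.
have H : stack_law lam i n (k :: l) * b k <=
    \sum_(k <- nbr (head i l)) stack_law lam i n (k :: l) * b k.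
  apply: (@sum_ge_mem _ _ _ (fun k => stack_law lam i n (k :: l) * b k)) kl =>
    j.
  by rewrite mulr_ge0 ?stack_law_ge0.
apply: le_trans H _; case: l {kl} => [|j l] /=.
  by rewrite lerDr mulr_ge0 ?stack_law_ge0.
by rewrite lerDr mulr_ge0 ?stack_law_ge0.
Qed.

(** For every [D > n] this is the expectation of [g] at time [n] on the event of survival, since
    heights are then at most [n]. The cutoff [D] stays free so that different times can share one
    index set. *)
Definition stack_sum (D : nat) lam i n (g : seq G -> R) : R :=
  \sum_(d < D) \sum_(l <- stacks i d) stack_law lam i n l * g l.

(** The transition operator, adjoint to the recursion of [stack_law]. *)
Definition stack_step lam i (g : seq G -> R) l : R :=
  \sum_(k <- nbr (head i l)) p (head i l) k * g (k :: l) +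
  (if l is k :: l' then b k * g l' else lam * g [::]).

Lemma stack_sumS D lam i n g :
  (n.+1 < D)%N -> stack_sum D lam i n.+1 g = stack_sum D lam i n (stack_step
    lam i g).
Proof.
case: D => // D; rewrite ltnS => nD; rewrite /stack_sum.
(* [A d] collects the pushes out of level [d], [B d] the pops out of level [d.+1]; the cutoff costs
   nothing because levels above [n] carry no mass. *)
pose B d := \sum_(l <- stacks i d.+1) stack_law lam i n l * (b (head i l) * g
  (behead l)).
pose A d := \sum_(l <- stacks i d) stack_law lam i n l *
  \sum_(k <- nbr (head i l)) p (head i l) k * g (k :: l).
have z d (F : seq G -> R) : (n < d)%N -> \sum_(l <- stacks i d) stack_law lam i
  n l * F l = 0.
  move=> nd; rewrite big_seq big1 // => l; rewrite mem_stacks => /andP[/eqP sl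
    _].
  by rewrite stack_law_size ?mul0r // sl.
transitivity (lam * stack_law lam i n [::] * g [::] + B 0%N + \sum_(d < D) (A d
  + B d.+1)).
  rewrite big_ord_recl; congr (_ + _).
    rewrite sum_stacks0 /= mulrDl; congr (_ + _);
      rewrite mulr_suml /B sum_stacksS sum_stacks0.
    by apply: eq_bigr => k _; rewrite -mulrA.
  apply: eq_bigr => d _; rewrite sum_stacksS /A /B.
  rewrite [X in _ + X]sum_stacksS [X in _ + X]sum_stacksS -big_split /=.
  apply: eq_bigr => l _; rewrite mulr_sumr -big_split /=; apply: eq_bigr => k _.
  rewrite mulrDl -mulrA mulr_suml; congr (_ + _).
  by apply: eq_bigr => m _; rewrite -!mulrA.
transitivity (\sum_(d < D.+1) A d + (lam * stack_law lam i n [::] * g [::] +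
  \sum_(d < D) B d)).
  rewrite big_split /= [in RHS]big_ord_recr /= [A D]z // addr0.
  have -> : \sum_(d < D) B d = B 0%N + \sum_(d < D) B d.+1.
    rewrite -(big_ord_recl D (fun d => B d)) /= [RHS]big_ord_recr /= [X in _ +
      X]z ?addr0 //.
    by rewrite ltnS ltnW.
  by rewrite /=; ring.
have -> : \sum_(d < D.+1) \sum_(l <- stacks i d) stack_law lam i n l *
  stack_step lam i g l =
  \sum_(d < D.+1) A d + \sum_(d < D.+1) \sum_(l <- stacks i d) stack_law lam i
    n l *
    (if l is k :: l' then b k * g l' else lam * g [::]).
  rewrite -big_split; apply: eq_bigr => d _ /=; rewrite -big_split.
  by apply: eq_bigr => l _; rewrite /stack_step mulrDr.
congr (_ + _); rewrite big_ord_recl sum_stacks0 /=; congr (_ + _);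
  first by ring.
by apply: eq_bigr => d _; rewrite /bump /= /B !sum_stacksS;
  apply: eq_bigr => l _.
Qed.

Lemma stack_sum0 D lam i g : (0 < D)%N -> stack_sum D lam i 0 g = g [::].
Proof.
case: D => // D _; rewrite /stack_sum big_ord_recl sum_stacks0 /= mul1r big1
  ?addr0 // => d _.
rewrite big_seq big1 // => l; rewrite mem_stacks => /andP[/eqP + _].
by case: l => //= j l _; rewrite mul0r.
Qed.

Lemma stack_sum_nil D lam i n :
  (0 < D)%N -> stack_sum D lam i n (fun l => (l == [::])%:R) =
    stack_law lam i n [::].
Proof.
case: D => // D _; rewrite /stack_sum big_ord_recl sum_stacks0 /= mulr1 big1
  ?addr0 // => d _.
rewrite big_seq big1 // => l; rewrite mem_stacks => /andP[/eqP + _].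
by case: l => //= j l _; rewrite mulr0.
Qed.

Lemma eq_stack_sum D lam i n g h : (forall l, is_stack i l -> g l = h l) ->
  stack_sum D lam i n g = stack_sum D lam i n h.
Proof.
move=> gh; apply: eq_bigr => d _; rewrite big_seq [RHS]big_seq.
by apply: eq_bigr => l; rewrite mem_stacks => /andP[_ /gh ->].
Qed.

Lemma le_stack_sum D lam i n g h : 0 <= lam ->
  (forall l, is_stack i l -> (size l <= n)%N -> g l <= h l) ->
    stack_sum D lam i n g <= stack_sum D lam i n h.
Proof.
move=> lam0 gh; apply: ler_sum => d _; rewrite big_seq [leRHS]big_seq.
apply: ler_sum => l; rewrite mem_stacks => /andP[_ okl].
have [ln|nl] := leqP (size l) n; last by rewrite stack_law_size // !mul0r.
by rewrite ler_wpM2l ?stack_law_ge0 // gh.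
Qed.

Lemma stack_sumZ D lam i n c g :
  stack_sum D lam i n (fun l => c * g l) = c * stack_sum D lam i n g.
Proof.
rewrite /stack_sum mulr_sumr; apply: eq_bigr => d _; rewrite mulr_sumr.
by apply: eq_bigr => l _; rewrite mulrCA.
Qed.

Lemma stack_sumD D lam i n g h :
  stack_sum D lam i n (fun l => g l + h l) = stack_sum D lam i n g + stack_sum
    D lam i n h.
Proof.
rewrite /stack_sum -big_split; apply: eq_bigr => d _; rewrite -big_split.
by apply: eq_bigr => l _; rewrite mulrDr.
Qed.

Hypothesis p_sum : forall i, \sum_(j <- nbr i) p i j = 1 - b i.

(** Mass disappears only at the bottom, where the walk leaves with probability [b i] and only [lam]
    is put back. There is no loss when [lam = b i]. *)
Lemma stack_sum_mass D lam i n : (n < D)%N ->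
  stack_sum D lam i n (fun=> 1) = 1 - (b i - lam) * \sum_(m < n) stack_law lam
    i m [::].
Proof.
elim: n => [|n IH] nD; first by rewrite big_ord0 mulr0 subr0 stack_sum0.
rewrite stack_sumS // (@eq_stack_sum _ _ _ _ _ (fun l => 1 + - (b i - lam) * (l
  == [::])%:R)).
  have n1 := ltnW nD; have D0 : (0 < D)%N := leq_ltn_trans (leq0n n) n1.
  rewrite stack_sumD stack_sumZ (stack_sum_nil _ _ _ D0) (IH n1) big_ord_recr
    /=.
  by set S := \sum_(_ < _) _; ring.
move=> l _; rewrite /stack_step; under eq_bigr do rewrite mulr1.
by rewrite p_sum; case: l => [|k l] /=; ring.
Qed.

End Stacks.

Arguments stacks : simpl never.

Fixpoint path_weight (R : realType) (G : eqType) (q : G -> G -> R) (i : G)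
    (l : seq G) : R :=
  if l is k :: l' then path_weight q i l' * q (head i l') k else 1.

(** * Elementary growth estimates *)

Section RealFacts.
Variable R : realType.

Lemma bernoulli (h : R) n : 0 <= h -> 1 + n%:R * h <= (1 + h) ^+ n.
Proof.
move=> h0; elim: n => [|n IH]; first by rewrite mul0r addr0 expr0.
rewrite exprS; apply: (@le_trans _ _ ((1 + h) * (1 + n%:R * h))).
  rewrite -natr1; have : 0 <= h * (n%:R * h) by rewrite !mulr_ge0.
  by lra.
by rewrite ler_wpM2l // addr_ge0.
Qed.

Lemma exprn_bounded_le1 (x K : R) : (forall m, x ^+ m <= K) -> x <= 1.
Proof.
move=> xK; rewrite leNgt; apply/negP => x1.
have h0 : 0 < x - 1 by rewrite subr_gt0.
pose m := (Num.trunc (`|K| / (x - 1))).+1.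
have Km : `|K| < m%:R * (x - 1).
  rewrite -ltr_pdivrMr //.
  by have /truncn_itv/andP[] : 0 <= `|K| / (x - 1) by rewrite divr_ge0 // ltW.
have := bernoulli m (ltW h0); rewrite [1 + (x - 1)]addrC subrK => H.
have := le_lt_trans (ler_norm K) Km; have := xK m.
by move: H; set y := x ^+ m; lra.
Qed.

Lemma sums_to_recl (f g : nat -> R) t :
  (forall n, f n.+1 = g n) -> sums_to g t ->
  sums_to f (f 0%N + t).
Proof.
move=> fg gt; pose d n : R := if n is 0%N then f 0%N else 0.
have hd : sums_to d (f 0%N).
  rewrite /sums_to -(cvg_shiftS (series d)).
  rewrite (_ : [sequence _]_n = fun=> f 0%N); first exact: cvg_cst.
  by apply/funext => n /=; rewrite series_ordE big_ord_recl big1 ?addr0.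
apply: sums_to_ext (sums_toD hd (sums_to_shift gt)) => -[|n] /=;
  first by rewrite addr0.
by rewrite add0r fg.
Qed.

(* Writing [w = 1 + (z - 1) / 4], one has [n <= w ^ n / (w - 1)] and [w ^ 2 < z]. *)
Lemma quadratic_geometric_summable (z : R) : 1 < z <= 2 ->
  exists B, sums_to (fun n => (1 + n%:R) ^+ 2 * z^-1 ^+ n) B.
Proof.
move=> /andP[z1 z2]; pose h := (z - 1) / 4; have h0 : 0 < h by rewrite /h; lra.
have w1 : 1 < z / (1 + h) ^+ 2.
  by rewrite ltr_pdivlMr ?mul1r ?exprn_gt0 /h //; nra.
have hs := sums_toZ ((1 + h^-1) ^+ 2) (sums_to_geometric w1).
have f0 n : 0 <= (1 + n%:R) ^+ 2 * z^-1 ^+ n.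
  by rewrite mulr_ge0 ?sqr_ge0 ?exprn_ge0 ?invr_ge0 //; lra.
have fg n : (1 + n%:R) ^+ 2 * z^-1 ^+ n <=
    (1 + h^-1) ^+ 2 * (z / (1 + h) ^+ 2)^-1 ^+ n.
  have -> : (z / (1 + h) ^+ 2)^-1 ^+ n = ((1 + h) ^+ n) ^+ 2 * z^-1 ^+ n.
    by rewrite invf_div exprMn_comm; [rewrite -!exprM mulnC|exact: mulrC].
  rewrite mulrA -exprMn_comm; last exact: mulrC.
  have zn0 : 0 <= z^-1 ^+ n by rewrite exprn_ge0 // invr_ge0; lra.
  apply: ler_wpM2r => //.
  have hV0 : 0 <= h^-1 by rewrite invr_ge0 ltW.
  have hn0 : 0 <= (1 + h) ^+ n by rewrite exprn_ge0 //; lra.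
  have n0 : 0 <= n%:R :> R by [].
  have a0 : 0 <= 1 + n%:R :> R by lra.
  have b0 : 0 <= (1 + h^-1) * (1 + h) ^+ n by apply: mulr_ge0 => //; lra.
  rewrite lerXn2r ?nnegrE //.
  have := bernoulli n (ltW h0) => H.
  have H1 : 1 <= (1 + h) ^+ n.
    by apply: le_trans H; rewrite lerDl mulr_ge0 // ltW.
  rewrite mulrDl mul1r; apply: lerD => //.
  by rewrite ler_pdivlMl // mulrC; lra.
by have [s ? _] := sums_to_dominated f0 fg hs; exists s.
Qed.

End RealFacts.

(** The quantitative form of the hypotheses. [gw_decay] is how a spectral radius below 1 enters;
    [z <= 2] is a normalization, since lowering [z] weakens the decay. [gw_reach] provides a vertex
    other than the root for each label. *)
Record good_walk (R : realType) (G : eqType) (nbr : G -> seq G)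
    (p : G -> G -> R) (b : G -> R) (i0 : G) (eps z C : R) : Prop := GoodWalk {
  gw_uniq : forall i, uniq (nbr i);
  gw_p0 : forall i j, 0 <= p i j;
  gw_eps : 0 < eps;
  gw_b : forall i, eps <= b i;
  gw_p : forall i j, j \in nbr i -> eps <= p i j;
  gw_sum : forall i, \sum_(j <- nbr i) p i j = 1 - b i;
  gw_reach : forall i, exists l, is_stack nbr i0 (i :: l);
  gw_conn : forall i j, exists l, is_stack nbr i l /\ head i l = j;
  gw_z : 1 < z <= 2;
  gw_decay : forall n, stack_law nbr p b (b i0) i0 n [::] <= C * z^-1 ^+ n }.

(** * Green functions and the exit chain *)

Section Green.
Variables (R : realType) (G : eqType) (nbr : G -> seq G) (p : G -> G -> R).
Variables (b : G -> R) (i0 : G) (eps z C : R).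
Hypothesis W : good_walk nbr p b i0 eps z C.
Implicit Types (i j k : G) (l y : seq G) (lam : R).

Local Notation M := (stack_law nbr p b).
Local Notation gb := (loop_law nbr p b).
Local Notation okst := (is_stack nbr).

Let p0 := gw_p0 W.
Let eps0 := gw_eps W.

Lemma gw_eps_ge0 : 0 <= eps. Proof. exact: ltW. Qed.

Lemma gw_b_ge0 i : 0 <= b i.
Proof. by apply: le_trans (ltW eps0) (gw_b W i). Qed.

Lemma gw_b_le1 i : b i <= 1.
Proof. by rewrite -subr_ge0 -(gw_sum W) sumr_ge0. Qed.

Lemma gw_p_le1 i j : j \in nbr i -> p i j <= 1.
Proof.
move=> jn; apply: le_trans (sum_ge_mem (p0 i) jn) _.
by rewrite (gw_sum W) gerBl gw_b_ge0.
Qed.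

Lemma gw_eps_le1 : eps <= 1.
Proof. exact: le_trans (gw_b W i0) (gw_b_le1 _). Qed.

Let b0 := gw_b_ge0.
Let gb0 i n : 0 <= gb i n := loop_law_ge0 nbr p0 b0 i n.

Lemma stack_law_reach lam i l :
  0 <= lam -> okst i l -> eps ^+ size l <= M lam i (size l) l.
Proof.
move=> lam0; elim: l => [|k l IH] //= /andP[kl okl].
apply: le_trans (stack_law_push nbr p0 b0 _ _ _ _ lam0); rewrite exprSr.
by apply: ler_pM; rewrite ?exprn_ge0 ?gw_eps_ge0 ?IH ?(gw_p W).
Qed.

Lemma stack_law_return lam i n y l : 0 <= lam -> okst i (y ++ l) ->
  M lam i n (y ++ l) * eps ^+ size y <= M lam i (n + size y) l.
Proof.
move=> lam0; elim: y n => [|k y IH] n /= ok; first by rewrite mulr1 addn0.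
have /andP[kl okl] := ok.
rewrite addnS -addSn exprS mulrA; apply: le_trans (IH n.+1 okl).
rewrite ler_wpM2r ?exprn_ge0 ?gw_eps_ge0 //.
apply: le_trans (stack_law_pop p0 b0 _ lam0 kl).
by rewrite ler_wpM2l ?(stack_law_ge0 _ p0 b0) // (gw_b W).
Qed.

(** The decay at the root gives a bound with a constant depending on the depth of [i]. Applied to
    the time [m * n] together with supermultiplicativity, it bounds all powers of [gb i n * z ^+ n]
    by that constant, so this number is at most 1 whatever the constant was. *)
Lemma loop_law_geometric i n : gb i n <= z^-1 ^+ n.
Proof.
have z0 : 0 < z by have /andP[/(lt_trans ltr01)] := gw_z W.
have zV0 : 0 <= z^-1 by rewrite invr_ge0 ltW.
have [l okl] := gw_reach W i; have bi0 := b0 i0.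
pose D : R := eps ^+ ((size l).+1 + (size l).+1).
have D0 : 0 < D by rewrite exprn_gt0.
have C0 : 0 <= C.
  by have := gw_decay W 0; rewrite expr0 mulr1 => /(le_trans _); apply.
(* Climb to [i :: l], loop there for [m] steps, and descend to the root: [D] is the price of the two
   journeys. *)
have key m : gb i m <= C / D * z^-1 ^+ m.
  rewrite -mulrA [D^-1 * _]mulrC mulrA ler_pdivlMr //.
  apply: (@le_trans _ _ (M (b i0) i0 ((size l) + m).+1 (i :: l) * eps ^+ (size
    l).+1)).
    rewrite /D exprD mulrA ler_wpM2r ?exprn_ge0 ?gw_eps_ge0 //.
    have := stack_law_cat nbr p b (b i0) i0 (size l + m).+1 [::] i l;
      rewrite /= => ->.
    have /andP[il okl'] := okl.
    rewrite exprS mulrCA ler_pM ?mulr_ge0 ?exprn_ge0 ?gw_eps_ge0 ?(gw_p W) //.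
    have ml : (size l < (size l + m).+1)%N by rewrite ltnS leq_addr.
    rewrite /conv (bigD1 (Ordinal ml)) //= addKn mulrC.
    rewrite -[X in X <= _]addr0 lerD //.
      by rewrite ler_wpM2r // stack_law_reach.
    by apply: sumr_ge0 => r _; rewrite mulr_ge0 ?(stack_law_ge0 _ p0 b0).
  have := @stack_law_return (b i0) i0 (size l + m).+1 (i :: l) [::].
  rewrite cats0 => /(_ bi0 okl) /le_trans; apply.
  apply: le_trans (gw_decay W _) _; rewrite ler_wpM2l //.
  apply: ler_wiXn2l => //=; last by lia.
  by rewrite invf_le1 //; have /andP[/ltW] := gw_z W.
have pw m : gb i n ^+ m <= gb i (m * n).
  elim: m => [|m IH]; first by rewrite mul0n expr0.
  rewrite exprSr mulSn addnC.
  apply: le_trans (stack_law_supermul nbr p0 b0 _ _ _ _ (lexx _)).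
  by rewrite ler_wpM2r.
rewrite exprVn -[_ ^-1]mul1r ler_pdivlMr ?exprn_gt0 //.
apply: (@exprn_bounded_le1 _ _ (C / D)) => m.
rewrite exprMn_comm; last exact: mulrC.
rewrite -exprM mulnC -ler_pdivlMr ?exprn_gt0 // -(exprVn z).
exact: le_trans (pw m) (key _).
Qed.

(** This is $\overline{G}_i(1)$, as [G_barE] confirms. *)
Definition loop_green i := limn (series (gb i)).

Lemma loop_green_sums i : sums_to (gb i) (loop_green i).
Proof.
have /andP[z1 _] := gw_z W.
have [s hs _] := sums_to_dominated (gb0 i) (loop_law_geometric i)
  (sums_to_geometric z1).
by rewrite /loop_green (cvg_lim (@Rhausdorff R) hs).
Qed.

Arguments loop_green_sums i : clear implicits.

Lemma loop_green_ge1 i : 1 <= loop_green i.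
Proof.
by have := sums_to_partial 1 (gb0 i) (loop_green_sums i); rewrite big_ord1.
Qed.

Lemma loop_green_gt0 i : 0 < loop_green i.
Proof. exact: lt_le_trans (loop_green_ge1 i). Qed.

Lemma loop_green_le i : loop_green i <= (1 - z^-1)^-1.
Proof.
have /andP[z1 _] := gw_z W.
have [s hs ss] := sums_to_dominated (gb0 i) (loop_law_geometric i)
  (sums_to_geometric z1).
by rewrite (sums_to_inj (loop_green_sums i) hs).
Qed.

(** A visit to the bottom is the start, a loop, or the pop of some [k]; by [stack_law_cat] the
    occupation of [[:: k]] is a push convolved with [gb k]. *)
Lemma green_equation lam i S :
  0 <= lam -> sums_to (fun n => M lam i n [::]) S ->
  S = 1 + (lam * S + \sum_(k <- nbr i) p i k * (S * loop_green k) * b k).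
Proof.
move=> lam0 hS.
have hk k : sums_to (fun n => M lam i n [:: k] * b k) (p i k * (S * loop_green
  k) * b k).
  rewrite mulrC; apply: sums_to_ext (sums_toZ (b k) (sums_toZ (p i k)
    (sums_to_shift (sums_to_conv _ (gb0 k) hS (loop_green_sums k))))) => n.
    by rewrite mulrC -[[:: k]]/([::] ++ k :: [::]) stack_law_cat.
  exact: stack_law_ge0.
have := @sums_to_recl _ (fun n => M lam i n [::]) _ _ (fun n => erefl _)
  (sums_toD (sums_toZ lam hS) (sums_to_big (r := nbr i) hk)).
exact: sums_to_inj.
Qed.

(** This is $F(-i)$, see [F_backE]: the walk falls by a pop that ends a loop. *)
Definition fall_prob i := b i * loop_green i.
Definition escape_prob i := 1 - fall_prob i.

Lemma fall_prob_le1 i : fall_prob i <= 1.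
Proof.
rewrite /fall_prob mulrC -ler_pdivlMr; last exact: lt_le_trans (gw_b W i).
apply: sums_to_le (loop_green_sums i) => n.
rewrite ler_pdivlMr; last exact: lt_le_trans (gw_b W i).
have := stack_sum_mass (gw_sum W) 0 i (ltnSn n).
rewrite subr0 => H; rewrite mulrC -subr_ge0 -[X in _ <= X]H.
apply: sumr_ge0 => d _; apply: sumr_ge0 => l _.
by rewrite mulr1 (stack_law_ge0 _ p0 b0).
Qed.

Lemma escape_prob_ge0 i : 0 <= escape_prob i.
Proof. by rewrite subr_ge0 fall_prob_le1. Qed.

(** The surviving mass only decreases in time, and the escape probability is its limit. *)
Lemma escape_prob_le_mass D i n :
  (n < D)%N -> escape_prob i <= stack_sum nbr p b D 0 i n (fun=> 1).
Proof.
move=> nD; rewrite (stack_sum_mass (gw_sum W)) // subr0 lerD2l lerN2.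
by rewrite ler_wpM2l ?b0 //; exact: sums_to_partial (loop_green_sums i).
Qed.

Lemma sum_escape_prob i : \sum_(k <- nbr i) p i k * escape_prob k =
  1 - b i - \sum_(k <- nbr i) p i k * fall_prob k.
Proof.
rewrite -(gw_sum W) -sumrB; apply: eq_bigr => k _.
by rewrite mulrBr mulr1.
Qed.

(** The Green equation with [lam = 0], rearranged. To escape is to push, at the last visit to the
    bottom, a label that is never popped. *)
Lemma escape_prob_harmonic i :
  loop_green i * (\sum_(k <- nbr i) p i k * escape_prob k) = escape_prob i.
Proof.
have := green_equation (lexx 0) (loop_green_sums i); rewrite mul0r add0r => H.
rewrite sum_escape_prob mulrBr /escape_prob /fall_prob mulr_sumr.
rewrite (eq_bigr (fun k => p i k * (loop_green i * loop_green k) * b k));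
  last by move=> k _; ring.
by move: H; set S := \sum_(_ <- _) _ => H; rewrite mulrBr mulr1 {1}H; ring.
Qed.

Definition root_green := limn (series (fun n => M (b i0) i0 n [::])).

Lemma root_green_sums : sums_to (fun n => M (b i0) i0 n [::]) root_green.
Proof.
have /andP[z1 _] := gw_z W.
have [s hs _] := sums_to_dominated (fun n => stack_law_ge0 nbr p0 b0 i0 n [::]
  (b0 i0))
  (gw_decay W) (sums_toZ C (sums_to_geometric z1)).
by rewrite /root_green (cvg_lim (@Rhausdorff R) hs).
Qed.

Lemma root_green_ge1 : 1 <= root_green.
Proof.
have := sums_to_partial 1 (fun n => stack_law_ge0 nbr p0 b0 i0 n [::] (b0 i0))
  root_green_sums.
by rewrite big_ord1.
Qed.

Lemma root_green_gt0 : 0 < root_green.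
Proof. exact: lt_le_trans root_green_ge1. Qed.

(** The same with [lam = b i0], where no mass is lost: the last visit to the root is followed by a
    push that is never undone. *)
Lemma root_green_harmonic :
  root_green * (\sum_(k <- nbr i0) p i0 k * escape_prob k) = 1.
Proof.
have := green_equation (b0 i0) root_green_sums => H.
rewrite sum_escape_prob mulrBr mulr_sumr.
rewrite (eq_bigr (fun k => p i0 k * (root_green * loop_green k) * b k));
  last first.
  by move=> k _; rewrite /fall_prob; ring.
by move: H; set S := \sum_(_ <- _) _ => H; rewrite mulrBr mulr1 {1}H; ring.
Qed.

Lemma escape_prob_descend i l :
  okst i l -> eps ^+ size l * escape_prob (head i l) <= escape_prob i.
Proof.
have step j k : k \in nbr j -> eps * escape_prob k <= escape_prob j.
  move=> kj; rewrite -(escape_prob_harmonic j).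
  apply: (@le_trans _ _ (1 * (p j k * escape_prob k))).
    by rewrite mul1r ler_wpM2r ?escape_prob_ge0 ?(gw_p W).
  apply: ler_pM; rewrite ?mulr_ge0 ?escape_prob_ge0 ?loop_green_ge1 //.
  by apply: (@sum_ge_mem _ _ _ (fun k => p j k * escape_prob k)) kj => m;
    rewrite mulr_ge0 ?escape_prob_ge0.
elim: l => [|k l IH] /=; first by rewrite mul1r.
move=> /andP[/step kl /IH]; apply: le_trans.
by rewrite exprSr -mulrA ler_wpM2l ?exprn_ge0 ?gw_eps_ge0.
Qed.

(** Finiteness of the root's Green function forces some child of the root to have a positive escape
    probability; strong connectedness carries this to every label. *)
Lemma escape_prob_gt0 i : 0 < escape_prob i.
Proof.
have [k _] : exists2 k, k \in nbr i0 & 0 < p i0 k * escape_prob k.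
  apply: sum_gt0_mem => [k|]; first by rewrite mulr_ge0 ?escape_prob_ge0.
  by rewrite -(pmulr_rgt0 _ root_green_gt0) root_green_harmonic.
have [l [okl hl]] := gw_conn W i k => puk.
apply: lt_le_trans (escape_prob_descend okl); rewrite hl mulr_gt0 ?exprn_gt0 //.
by have := escape_prob_ge0 k; rewrite le_eqVlt => /orP[/eqP e|//];
  rewrite -e mulr0 ltxx in puk.
Qed.

(* The matrix [Q] of the theorem. *)
Definition exit_kernel i j :=
  escape_prob j / escape_prob i * p i j * loop_green i.

Lemma exit_kernel_ge0 i j : 0 <= exit_kernel i j.
Proof.
by rewrite !mulr_ge0 ?invr_ge0 ?escape_prob_ge0 // ltW // loop_green_gt0.
Qed.

Lemma exit_kernel_sum i : \sum_(j <- nbr i) exit_kernel i j = 1.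
Proof.
have u0 := lt0r_neq0 (escape_prob_gt0 i); apply: (mulfI u0);
  rewrite mulr1 mulr_sumr.
rewrite -[RHS](escape_prob_harmonic i) mulr_sumr; apply: eq_bigr => j _.
by rewrite /exit_kernel; field.
Qed.

Lemma root_green_loop_green : root_green = loop_green i0 / escape_prob i0.
Proof.
apply: (mulIf (_ : \sum_(k <- nbr i0) p i0 k * escape_prob k != 0)).
  by apply/eqP => e; have := root_green_harmonic; rewrite e mulr0 => /esym/eqP;
    rewrite oner_eq0.
by rewrite root_green_harmonic mulrAC escape_prob_harmonic divff // gt_eqF //
  escape_prob_gt0.
Qed.

(** For [i = i0] this is $G(o,x)/G(o,o)$ with [l] the stack of [x], see [stack_law_sums]. *)
Fixpoint green_ratio i l : R :=
  if l is k :: l' then green_ratio i l' * p (head i l') k * loop_green k else 1.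

Local Notation qw := (path_weight exit_kernel i0).

(** The escape probabilities in [exit_kernel] telescope, leaving the expected number of visits to
    [l] times the probability of pushing [j] for good. So the labels of the final exits form the
    chain with kernel [exit_kernel]. *)
Lemma exit_weight_cons j l :
  qw (j :: l) = root_green * green_ratio i0 l * p (head i0 l) j * escape_prob j.
Proof.
elim: l j => [|k l IH] j.
  by rewrite /= mul1r mulr1 /exit_kernel root_green_loop_green; ring.
rewrite [LHS]/= -/(path_weight exit_kernel i0 (k :: l)) IH /= /exit_kernel.
by field; rewrite gt_eqF // escape_prob_gt0.
Qed.

Lemma green_ratio_ge0 i l : 0 <= green_ratio i l.
Proof.
by elim: l => //= k l IH; rewrite !mulr_ge0 // ltW // loop_green_gt0.
Qed.

Lemma green_ratio_ge i l : okst i l -> eps ^+ size l <= green_ratio i l.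
Proof.
elim: l => //= k l IH /andP[kl /IH h]; rewrite exprSr -[X in X <= _]mulr1.
rewrite !ler_pM ?mulr_ge0 ?exprn_ge0 ?gw_eps_ge0 ?(gw_p W) //;
  exact: loop_green_ge1.
Qed.

Lemma green_ratio_gt0 i l : okst i l -> 0 < green_ratio i l.
Proof. by move=> /green_ratio_ge; apply: lt_le_trans; rewrite exprn_gt0. Qed.

Lemma stack_law_cons lam i j l n :
  M lam i n (j :: l) = p (head i l) j * shift (conv (fun r => M lam i r l) (gb
    j)) n.
Proof. by rewrite -[j :: l]/([::] ++ j :: l) stack_law_cat. Qed.

Lemma stack_law_sums l :
  sums_to (fun n => M (b i0) i0 n l) (root_green * green_ratio i0 l).
Proof.
elim: l => [|k l IH]; first by rewrite mulr1; exact: root_green_sums.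
rewrite (_ : root_green * _ = p (head i0 l) k * (root_green * green_ratio i0 l
  * loop_green k)); last first.
  by rewrite /=; ring.
apply: sums_to_ext (sums_toZ _ (sums_to_shift (sums_to_conv _ (gb0 k) IH
  (loop_green_sums k)))) => n.
  by rewrite stack_law_cons.
by apply: stack_law_ge0 => //; exact: b0.
Qed.

End Green.

Arguments loop_green_sums {R G nbr p b i0 eps z C} W i.
Arguments root_green_sums {R G nbr p b i0 eps z C} W.
Arguments stack_law_sums {R G nbr p b i0 eps z C} W l.

(** * Means and variances of occupation times *)

Definition mean (R : realType) (f : nat -> R) : R :=
  limn (series (fun n => n%:R * f n)) / limn (series f).

Definition variance (R : realType) (f : nat -> R) : R :=
  limn (series (fun n => n%:R ^+ 2 * f n)) / limn (series f) - mean f ^+ 2.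

(** Both [n] and [n ^ 2] are below [(1 + n) ^ 2], and normalizing by a total [s >= 1] does not
    increase the bounds. *)
Lemma geometric_moments (R : realType) (z K B s : R) (f : nat -> R) :
  1 < z -> sums_to (fun n => (1 + n%:R) ^+ 2 * z^-1 ^+ n) B -> 0 <= K ->
  (forall n, 0 <= f n) -> (forall n, f n <= K * z^-1 ^+ n) ->
  sums_to f s -> 1 <= s ->
  [/\ has_moments f s (mean f) (variance f), 0 <= mean f <= K * B &
      variance f <= K * B].
Proof.
move=> z1 hB K0 f0 fz hs s1.
have s0 : 0 < s by exact: lt_le_trans s1.
have zn n : 0 <= z^-1 ^+ n by rewrite exprn_ge0 // invr_ge0; lra.
have n0 n : 0 <= n%:R :> R by [].
have [s1' h1 l1] : exists2 t, sums_to (fun n => n%:R * f n) t & t <= K * B.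
  apply: sums_to_dominated (sums_toZ K hB) => n; first by rewrite mulr_ge0.
  rewrite mulrCA; apply: ler_pM => //.
  by have := n0 n; nra.
have [s2 h2 l2] : exists2 t, sums_to (fun n => n%:R ^+ 2 * f n) t & t <= K * B.
  apply: sums_to_dominated (sums_toZ K hB) => n;
    first by rewrite mulr_ge0 ?sqr_ge0.
  rewrite mulrCA; apply: ler_pM; rewrite ?sqr_ge0 //.
  by have := n0 n; nra.
have g0 n : 0 <= n%:R * f n by rewrite mulr_ge0.
have k0 n : 0 <= n%:R ^+ 2 * f n by rewrite mulr_ge0 ?sqr_ge0.
have s10 := sums_to_ge0 g0 h1; have s20 := sums_to_ge0 k0 h2.
have E0 := cvg_lim (@Rhausdorff R) hs.
have E1 := cvg_lim (@Rhausdorff R) h1.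
have E2 := cvg_lim (@Rhausdorff R) h2.
have sn0 : s != 0 by rewrite gt_eqF.
have Em : mean f = s1' / s by rewrite /mean E0 E1.
have Ev : variance f = s2 / s - (s1' / s) ^+ 2 by rewrite /variance E0 E2 Em.
have div x : 0 <= x -> x <= K * B -> x / s <= K * B.
  move=> x0 xK; rewrite ler_pdivrMr //; apply: (le_trans xK).
  by rewrite ler_peMr //; exact: (le_trans x0).
split.
- rewrite Ev Em; split => //; first by rewrite divfK.
  by rewrite subrK divfK.
- by rewrite Em (divr_ge0 s10 (ltW s0)) div.
- by rewrite Ev lerBlDr; apply: le_trans (div _ s20 l2) _;
  rewrite lerDl sqr_ge0.
Qed.

Section Moments.
Variables (R : realType) (G : eqType) (nbr : G -> seq G) (p : G -> G -> R).
Variables (b : G -> R) (i0 : G) (eps z C : R).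
Hypothesis W : good_walk nbr p b i0 eps z C.
Implicit Types (i j k : G) (l y : seq G).

Local Notation M := (stack_law nbr p b).
Local Notation gb := (loop_law nbr p b).

Definition mean_wait i : R := mean (gb i).

(* Mean of the normalized occupation times [n |-> M (b i0) i0 n l] of [l]: the
   mean time at which the walk finally leaves [l] through a given child. *)
Definition mean_exit l : R :=
  mean (fun n => M (b i0) i0 n [::]) + \sum_(k <- l) (mean_wait k + 1).

(** The occupation times of [k :: l] are those of [l], one step, and a loop above [k], convolved.
    Hence the variance grows at most linearly with the height. *)
Lemma moments_bounded : exists2 B : R, 0 <= B &
  (forall k, 0 <= mean_wait k <= B) /\
  forall l, exists2 v, v <= B * (size l).+1%:R &
    has_moments (fun n => M (b i0) i0 n l) (root_green nbr p b i0 * green_ratio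
      nbr p b i0 l)
      (mean_exit l) v.
Proof.
have [B0 hB] := quadratic_geometric_summable (gw_z W).
have /andP[z1 _] := gw_z W.
have p0 := gw_p0 W; have b0 := gw_b_ge0 W.
have M0 l n : 0 <= M (b i0) i0 n l by apply: stack_law_ge0.
have gb0 i n : 0 <= gb i n by apply: loop_law_ge0.
have B00 : 0 <= B0.
  by apply: sums_to_ge0 hB => n; rewrite mulr_ge0 ?sqr_ge0 ?exprn_ge0 ?invr_ge0
    //; lra.
have C1 : 1 <= C by have := gw_decay W 0; rewrite expr0 mulr1.
have C0 : 0 <= C by exact: le_trans C1.
have CB : B0 <= C * B0 by rewrite ler_peMl.
have hg i : [/\ has_moments (gb i) (loop_green nbr p b i) (mean_wait i)
  (variance (gb i)),
    0 <= mean_wait i <= B0 & variance (gb i) <= B0].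
  rewrite -[B0]mul1r; apply: geometric_moments z1 hB _ (gb0 i) _ _
    (loop_green_ge1 W i) => //.
    by move=> n; rewrite mul1r; exact: (loop_law_geometric W).
  exact: (loop_green_sums W).
have [h0 /andP[m0 m1] v1] := geometric_moments z1 hB C0 (M0 [::]) (gw_decay W)
  (root_green_sums W) (root_green_ge1 W).
exists (C * B0); first by rewrite mulr_ge0.
split=> [k|l]; first by have [_ /andP[-> /le_trans->]] := hg k.
elim: l => [|k l [v vl IH]].
  exists (variance (fun n => M (b i0) i0 n [::])); first by rewrite mulr1.
  by rewrite mulr1 /mean_exit big_nil addr0.
have [hk _ vk] := hg k.
exists (v + variance (gb k)).
  by rewrite /= -[(size l).+2%:R]natr1 mulrDr mulr1; lra.
rewrite (_ : root_green nbr p b i0 * _ =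
  p (head i0 l) k * (root_green nbr p b i0 * green_ratio nbr p b i0 l *
    loop_green nbr p b k)); last first.
  by rewrite /=; ring.
rewrite (_ : mean_exit _ = mean_exit l + mean_wait k + 1); last first.
  by rewrite /mean_exit big_cons; ring.
have := has_momentsZ (p (head i0 l) k) (has_moments_shift (has_moments_conv (M0
  l) (gb0 k) IH hk)).
by congr has_moments; apply/funext => n; rewrite (stack_law_cons nbr p b).
Qed.

End Moments.

(** * A law of large numbers for additive functionals *)

Section Ergodic.
Variables (R : realType) (G : eqType) (nbr : G -> seq G) (q : G -> G -> R).
Variables (i0 : G).
Hypothesis q0 : forall i j, 0 <= q i j.
Hypothesis q1 : forall i, \sum_(j <- nbr i) q i j = 1.
Implicit Types (i j k : G) (l : seq G) (f g : G -> R).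

Local Notation pw := (path_weight q i0).
Local Notation hd := (head i0).

(* Trajectories are listed last state first, like stacks; the initial state [i0]
   is not listed. *)
Definition path_mean n (F : seq G -> R) : R :=
  \sum_(l <- stacks nbr i0 n) pw l * F l.

Definition kernel_op g i := \sum_(j <- nbr i) q i j * g j.

(** The kernel killed on entering [i0]: its iterates on 1 are the tails of the hitting time of [i0]
    after time 0. *)
Definition avoid_op g i := \sum_(j <- nbr i | j != i0) q i j * g j.

Fixpoint path_sum (phi : G -> G -> R) l : R :=
  if l is k :: l' then path_sum phi l' + phi (hd l') k else 0.

Lemma path_weight_ge0 l : 0 <= pw l.
Proof. by elim: l => //= k l IH; rewrite mulr_ge0. Qed.

Lemma path_meanS n F : path_mean n.+1 F =
  path_mean n (fun l => \sum_(j <- nbr (hd l)) q (hd l) j * F (j :: l)).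
Proof.
rewrite /path_mean sum_stacksS; apply: eq_bigr => l _; rewrite mulr_sumr.
by apply: eq_bigr => k _; rewrite mulrA.
Qed.

Lemma path_mean0 F : path_mean 0 F = F [::].
Proof. by rewrite /path_mean sum_stacks0 mul1r. Qed.

Lemma le_path_mean n F H :
  (forall l, is_stack nbr i0 l -> size l = n -> F l <= H l) ->
  path_mean n F <= path_mean n H.
Proof.
move=> FH; rewrite /path_mean big_seq [leRHS]big_seq; apply: ler_sum => l.
by rewrite mem_stacks => /andP[/eqP sl okl]; rewrite ler_wpM2l ?path_weight_ge0
  ?FH.
Qed.

Lemma eq_path_mean n F H :
  (forall l, F l = H l) -> path_mean n F = path_mean n H.
Proof. by move=> FH; apply: eq_bigr => l _; rewrite FH. Qed.

Lemma path_meanD n F H :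
  path_mean n (fun l => F l + H l) = path_mean n F + path_mean n H.
Proof.
by rewrite /path_mean -big_split; apply: eq_bigr => l _; rewrite mulrDr.
Qed.

Lemma path_meanZ n c F : path_mean n (fun l => c * F l) = c * path_mean n F.
Proof.
by rewrite /path_mean mulr_sumr; apply: eq_bigr => l _; rewrite mulrCA.
Qed.

Lemma path_mean_cst n c : path_mean n (fun=> c) = c.
Proof.
elim: n => [|n IH]; first exact: path_mean0.
by rewrite path_meanS -[RHS]IH; apply: eq_path_mean => l;
  rewrite -mulr_suml q1 mul1r.
Qed.

Lemma path_mean_kernel_op n g :
  path_mean n.+1 (g \o hd) = path_mean n (kernel_op g \o hd).
Proof. exact: path_meanS. Qed.

Definition avoid_mass n := iter n avoid_op (fun=> 1).

Lemma avoid_op_ge0 g : (forall i, 0 <= g i) -> forall i, 0 <= avoid_op g i.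
Proof. by move=> g0 i; apply: sumr_ge0 => j _; rewrite mulr_ge0. Qed.

Lemma iter_avoid_op_ge0 n f :
  (forall i, 0 <= f i) -> forall i, 0 <= iter n avoid_op f i.
Proof. by move=> f0; elim: n => //= n IH; exact: avoid_op_ge0. Qed.

Lemma avoid_mass_ge0 n i : 0 <= avoid_mass n i.
Proof. exact: iter_avoid_op_ge0. Qed.

Lemma iter_avoid_opB n f a i :
  iter n avoid_op (fun j => f j - a) i = iter n avoid_op f i - a * avoid_mass n
    i.
Proof.
elim: n i => [|n IH] i; first by rewrite /= mulr1.
rewrite /= {1}/avoid_op (eq_bigr (fun j => q i j * iter n avoid_op f j - a * (q
  i j * avoid_mass n j))).
  by rewrite sumrB -mulr_sumr.
by move=> j _; rewrite IH; ring.
Qed.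

Lemma iter_avoid_op_le n f B : (forall i, `|f i| <= B) ->
  forall i, `|iter n avoid_op f i| <= B * avoid_mass n i.
Proof.
move=> fB; elim: n => [|n IH] i /=; first by rewrite mulr1.
apply: le_trans (ler_norm_sum _ _ _) _; rewrite /avoid_mass /= {2}/avoid_op
  mulr_sumr.
apply: ler_sum => j _; rewrite normrM ger0_norm // mulrCA.
by rewrite ler_wpM2l.
Qed.

Definition hit_prob i := \sum_(j <- nbr i | j == i0) q i j.

Lemma hit_prob_ge0 i : 0 <= hit_prob i.
Proof. by apply: sumr_ge0. Qed.

Lemma hit_prob_le1 i : hit_prob i <= 1.
Proof.
by rewrite -(q1 i) [leRHS](bigID (fun j => j == i0)) /= lerDl sumr_ge0.
Qed.

Lemma kernel_op_avoid_op g i : kernel_op g i = avoid_op g i + hit_prob i * g i0.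
Proof.
rewrite /kernel_op (bigID (fun j => j == i0)) /= addrC; congr (_ + _).
by rewrite /hit_prob mulr_suml; apply: eq_bigr => j /eqP ->.
Qed.

(* Decompose according to the last visit to [i0] before time [m]. *)
Lemma path_mean_avoid_mass m n :
  path_mean m (avoid_mass n \o hd) <= \sum_(r < m.+1) avoid_mass (n + r) i0.
Proof.
elim: m n => [|m IH] n; first by rewrite path_mean0 big_ord1 addn0.
rewrite path_mean_kernel_op big_ord_recl addn0 /= -[X in X + _](path_mean_cst
  m) addrC.
apply: (@le_trans _ _ (path_mean m (fun l => avoid_mass n.+1 (hd l) +
  avoid_mass n i0))).
  apply: le_path_mean => l _ _ /=; rewrite kernel_op_avoid_op lerD2l.
  by rewrite ler_piMl ?avoid_mass_ge0 ?hit_prob_le1.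
rewrite path_meanD lerD2r; apply: le_trans (IH n.+1) _.
by apply: ler_sum => r _; have -> : (n + bump 0 r =
  n.+1 + r)%N by rewrite /bump /=; lia.
Qed.

Variable K : R.
Hypothesis hKK : forall n, \sum_(m < n) avoid_mass m i0 <= K.

(** The sum is split into a martingale with bounded increments, boundary terms of the potential
    [g N], and the accumulated error of the Poisson equation. Non-negativity of [phi] yields the
    series [S] by domination. *)
Lemma path_sum_lln_nonneg (phi : G -> G -> R) B :
  (forall i j, j \in nbr i -> 0 <= phi i j <= B) ->
  exists a, forall e, 0 < e -> exists N, forall n, (N <= n)%N ->
    path_mean n (fun l => `|path_sum phi l - n%:R * a|) <= e * n%:R.
Proof.
move=> phiB.
have [H hH] := sums_to_bounded (fun m => avoid_mass_ge0 m i0) hKK.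
have H1 : 1 <= H by have := sums_to_partial 1 (fun m => avoid_mass_ge0 m i0)
  hH; rewrite big_ord1.
have H0 : 0 < H by exact: lt_le_trans H1.
pose ft i := \sum_(j <- nbr i) q i j * phi i j.
have ft0 i : 0 <= ft i.
  rewrite /ft big_seq; apply: sumr_ge0 => j /phiB/andP[? _]; exact: mulr_ge0.
have ftB i : ft i <= B.
  rewrite -[B]mul1r -(q1 i) mulr_suml /ft big_seq [leRHS]big_seq.
  by apply: ler_sum => j /phiB/andP[_ ?]; rewrite ler_wpM2l.
have nft i : `|ft i| <= B by rewrite ger0_norm.
have B0 : 0 <= B := le_trans (ft0 i0) (ftB i0).
have c0 n : 0 <= iter n avoid_op ft i0 by apply: iter_avoid_op_ge0.
have cB n : iter n avoid_op ft i0 <= B * avoid_mass n i0.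
  by rewrite -[leLHS]ger0_norm //; exact: iter_avoid_op_le.
have [S hS SB] := sums_to_dominated c0 cB (sums_toZ B hH).
have S0 : 0 <= S := sums_to_ge0 c0 hS.
(* Mean cost of an excursion from [i0] over its mean length. *)
pose a := S / H; exists a.
have a0 : 0 <= a by rewrite divr_ge0 // ltW.
have aB : a <= B by rewrite ler_pdivrMr.
pose f i := ft i - a.
have fB i : `|f i| <= B.
  by rewrite ler_norml /f; have := ft0 i; have := ftB i; lra.
pose g N i := \sum_(m < N) iter m avoid_op f i.
have gS N i : g N.+1 i = f i + avoid_op (g N) i.
  rewrite /g big_ord_recl /=; congr (_ + _); rewrite /avoid_op.
  by rewrite exchange_big /=; apply: eq_bigr => j _; rewrite mulr_sumr.
(* [S - a * H = 0]: by the choice of [a], a full excursion has centred cost zero on average. *)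
have g_i0 : g ^~ i0 @ \oo --> (0 : R).
  have -> : g ^~ i0 = series (fun m => iter m avoid_op ft i0 + - a * avoid_mass
    m i0).
    apply/funext => N; rewrite series_ordE; apply: eq_bigr => m _.
    by rewrite iter_avoid_opB mulNr.
  have -> : 0 = S + - a * H by rewrite mulNr divfK ?subrr // gt_eqF.
  exact: sums_toD hS (sums_toZ (- a) hH).
have tail0 : (fun N => H - \sum_(m < N) avoid_mass m i0) @ \oo --> (0 : R).
  suff : (fun N => H - \sum_(m < N) avoid_mass m i0) @ \oo --> H - H by rewrite
    subrr.
  apply: cvgB; first exact: cvg_cst.
  rewrite (_ : (fun N => _) = series (fun m => avoid_mass m i0)) //.
  by apply/funext => N; rewrite series_ordE.
move=> e e0.
have e4 : 0 < e / 4 by lra.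
have eB : 0 < e / (4 * (B + 1)) by rewrite divr_gt0 // mulr_gt0 //; lra.
have [N gN tN] : exists2 N, `|g N i0| <= e / 4 &
    B * (H - \sum_(m < N) avoid_mass m i0) <= e / 4.
  have /cvgrPdist_le/(_ _ e4) P1 := g_i0.
  have /cvgrPdist_le/(_ _ eB) P2 := tail0.
  have [N /= _ PN] : \forall N \near \oo, `|0 - g N i0| <= e / 4 /\
    `|0 - (H - \sum_(m < N) avoid_mass m i0)| <= e / (4 * (B + 1)) by near=> N;
      split; near: N.
  have [/= Q1 Q2] := PN N (leqnn N); exists N; first by rewrite -normrN -sub0r.
  rewrite sub0r normrN in Q2.
  have Q3 := le_trans (ler_norm _) Q2.
  apply: (@le_trans _ _ (B * (e / (4 * (B + 1))))); first by rewrite ler_wpM2l.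
  have -> : B * (e / (4 * (B + 1))) = e / 4 * (B / (B + 1)) by field; lra.
  by rewrite ler_piMr ?(ltW e4) // ler_pdivrMr; lra.
(* The defect in the Poisson equation: the first term comes from stopping after [N] steps, the
   second from killing at [i0]. *)
pose ep i := iter N avoid_op f i + hit_prob i * g N i0.
have poisson i : f i + kernel_op (g N) i - g N i = ep i.
  rewrite kernel_op_avoid_op /ep; have := gS N i;
    rewrite {1}/g big_ord_recr /= -/(g N i).
  by move=> E; lra.
have epB i : `|ep i| <= B * avoid_mass N i + e / 4.
  apply: le_trans (ler_normD _ _) _; apply: lerD; first exact: iter_avoid_op_le.
  rewrite normrM (ger0_norm (hit_prob_ge0 i)).
  by apply: le_trans gN; rewrite ler_piMl ?hit_prob_le1.
pose Dg := B * \sum_(m < N) 1.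
have hK1 m i : avoid_mass m i <= 1.
  elim: m i => [|m IH] i //=; rewrite /avoid_mass /= -/(avoid_mass m).
  have := kernel_op_avoid_op (avoid_mass m) i;
    have := mulr_ge0 (hit_prob_ge0 i) (avoid_mass_ge0 m i0).
  suff : kernel_op (avoid_mass m) i <= 1 by lra.
  rewrite -(q1 i); apply: ler_sum => j _; rewrite -[leRHS]mulr1 ler_wpM2l //.
have gB i : `|g N i| <= Dg.
  apply: le_trans (ler_norm_sum _ _ _) _; rewrite /Dg mulr_sumr;
    apply: ler_sum => m _.
  by apply: le_trans (iter_avoid_op_le _ fB i) _; rewrite ler_wpM2l.
pose xi i j := phi i j - a + g N j - g N i - ep i.
have xi0 i : \sum_(j <- nbr i) q i j * xi i j = 0.
  rewrite (eq_bigr (fun j => q i j * phi i j + q i j * g N j + q i j * (- a - g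
    N i - ep i))).
    rewrite !big_split /= -mulr_suml q1 mul1r -/(ft i) -/(kernel_op (g N) i)
      -poisson /f.
    by ring.
  by move=> j _; rewrite /xi; ring.
pose D := B + B + Dg + Dg + (B + e / 4).
have xiB i j : j \in nbr i -> `|xi i j| <= D.
  move=> /phiB/andP[ph0 phB].
  have := gB i; have := gB j; have := epB i; have : B * avoid_mass N i <=
    B by rewrite ler_piMr.
  by rewrite !ler_norml /xi /D => ? /andP[? ?] /andP[? ?] /andP[? ?]; lra.
(* Martingale increments are orthogonal, so the second moment grows linearly. *)
have Z2 n : path_mean n (fun l => path_sum xi l ^+ 2) <= n%:R * D ^+ 2.
  elim: n => [|n IH]; first by rewrite path_mean0 mul0r expr0n.
  rewrite path_meanS -natr1 mulrDl mul1r; apply: le_trans (lerD IH (lexx _)).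
  rewrite -[X in _ + X](path_mean_cst n) -path_meanD;
    apply: le_path_mean => l _ _ /=.
  rewrite (eq_bigr (fun j => q (hd l) j * path_sum xi l ^+ 2 +
     (2 * path_sum xi l) * (q (hd l) j * xi (hd l) j) + q (hd l) j * xi (hd l)
       j ^+ 2)).
    rewrite !big_split /= -mulr_suml q1 mul1r -mulr_sumr xi0 mulr0 addr0 lerD2l.
    rewrite -[D ^+ 2]mul1r -(q1 (hd l)) mulr_suml big_seq [leRHS]big_seq.
    apply: ler_sum => j /xiB jD; rewrite ler_wpM2l //.
    by rewrite -(ger0_norm (sqr_ge0 (xi _ _))) normrX lerXn2r ?nnegrE
      ?(le_trans _ jD).
  by move=> j _; ring.
have Ea n : path_mean n (path_sum (fun i _ => `|ep i|)) <=
  n%:R * (e / 4 + e / 4).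
  elim: n => [|n IH]; first by rewrite path_mean0 mul0r.
  rewrite path_meanS -natr1 mulrDl mul1r; apply: le_trans (lerD IH (lexx _)).
  rewrite (@eq_path_mean _ _ (fun l => path_sum (fun i _ => `|ep i|) l + `|ep
    (hd l)|)).
    rewrite path_meanD lerD2l.
    apply: (@le_trans _ _ (path_mean n (fun l => B * (avoid_mass N \o hd) l + e
      / 4))).
      by apply: le_path_mean => l _ _ /=.
    rewrite path_meanD path_meanZ path_mean_cst lerD2r; apply: le_trans tN;
      rewrite ler_wpM2l //.
    (* The average of [avoid_mass N] along the chain is at most a tail of the series of sum [H],
       which [tN] makes small uniformly in [n]. *)
    apply: le_trans (path_mean_avoid_mass n N) _; rewrite lerBrDl.
    apply: le_trans (sums_to_partial (N + n.+1) (fun m => avoid_mass_ge0 m i0)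
      hH).
    by rewrite big_split_ord.
  by move=> l /=; rewrite -mulr_suml q1 mul1r.
exists (Num.trunc ((D ^+ 2 / (2 * (e / 4)) + 2 * Dg) / (e / 4))).+1 => n Nn.
have nbig : D ^+ 2 / (2 * (e / 4)) + 2 * Dg <= e / 4 * n%:R.
  rewrite [leRHS]mulrC -ler_pdivrMr //; apply: ltW.
  by apply: lt_le_trans (truncnS_gt _) _; rewrite ler_nat.
have n0 : 0 < n%:R :> R by rewrite ltr0n (leq_trans _ Nn).
pose t := e / 4 * n%:R; have t0 : 0 < t by rewrite mulr_gt0.
have t20 : 0 <= 2 * t by lra.
(* The potential telescopes along the trajectory. *)
have split_sum l : path_sum phi l - (size l)%:R * a =
    path_sum xi l - g N (hd l) + g N i0 + path_sum (fun i _ => ep i) l.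
  elim: l => [|j l IH] /=; first by ring.
  rewrite -natr1; have -> : path_sum phi l = path_sum xi l - g N (hd l) + g N
    i0 +
    path_sum (fun i _ => ep i) l + (size l)%:R * a by rewrite -IH; ring.
  by rewrite /xi; ring.
have abs_ep l : `|path_sum (fun i _ => ep i) l| <=
  path_sum (fun i _ => `|ep i|) l.
  elim: l => [|j l IH] /=; first by rewrite normr0.
  by apply: le_trans (ler_normD _ _) _; rewrite lerD2r.
apply: (@le_trans _ _ (path_mean n (fun l => (2 * t)^-1 * path_sum xi l ^+ 2 +
    (t / 2 + 2 * Dg + path_sum (fun i _ => `|ep i|) l)))).
  apply: le_path_mean => l _ sl; rewrite -[in n%:R]sl split_sum.
  apply: le_trans (ler_normD _ _) _; rewrite [leRHS]addrA; apply: lerD => //.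
  have : `|path_sum xi l| <= (2 * t)^-1 * path_sum xi l ^+ 2 + t / 2.
    rewrite -[path_sum xi l ^+ 2]ger0_norm ?sqr_ge0 // normrX; set x := `|_|.
    have : 0 <= (x - t) ^+ 2 / (2 * t) by exact: divr_ge0 (sqr_ge0 _) t20.
    have -> : (x - t) ^+ 2 / (2 * t) = (2 * t)^-1 * x ^+ 2 + t / 2 - x.
      by field; rewrite gt_eqF.
    by lra.
  have := gB (hd l); have := gB i0; have := ler_normD (path_sum xi l - g N (hd
    l)) (g N i0).
  have := ler_normB (path_sum xi l) (g N (hd l)); lra.
rewrite path_meanD path_meanZ path_meanD path_mean_cst.
have : (2 * t)^-1 * path_mean n (fun l => path_sum xi l ^+ 2) <=
  D ^+ 2 / (2 * (e / 4)).
  apply: (@le_trans _ _ ((2 * t)^-1 * (n%:R * D ^+ 2))).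
    by rewrite ler_wpM2l ?invr_ge0.
  by rewrite /t le_eqVlt; apply/orP; left; apply/eqP; field; rewrite !gt_eqF.
have := Ea n; have : t / 2 = e / 8 * n%:R by rewrite /t; field.
have : 0 < e * n%:R by rewrite mulr_gt0.
by move: nbig; lra.
Unshelve. all: end_near. Qed.

(** Adding [B] to [phi] makes it non-negative and moves the limit by [B]. *)
Lemma path_sum_lln (phi : G -> G -> R) B :
  (forall i j, j \in nbr i -> `|phi i j| <= B) ->
  exists a, forall e, 0 < e -> exists N, forall n, (N <= n)%N ->
    path_mean n (fun l => `|path_sum phi l - n%:R * a|) <= e * n%:R.
Proof.
move=> phiB; have [|a ha] := @path_sum_lln_nonneg (fun i j => phi i j + B) (B +
  B).
  by move=> i j /phiB; rewrite ler_norml => /andP[? ?]; apply/andP; split; lra.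
exists (a - B) => e /ha [N hN]; exists N => n /hN; apply: le_trans.
apply: le_path_mean => l _ <-.
suff -> : path_sum (fun i j => phi i j + B) l = path_sum phi l + (size l)%:R *
  B.
  by rewrite le_eqVlt; apply/orP; left; apply/eqP; congr `|_|; ring.
by elim: l => [|j l IH] /=; rewrite ?mul0r ?addr0 // IH -natr1; ring.
Qed.

End Ergodic.

(** * Final exits *)

Arguments stack_law : simpl never.

Section Coupling.
Variables (R : realType) (G : eqType) (nbr : G -> seq G) (p : G -> G -> R).
Variables (b : G -> R) (i0 : G) (eps z C : R).
Hypothesis W : good_walk nbr p b i0 eps z C.
Implicit Types (i j k : G) (l y v : seq G).

Local Notation M := (stack_law nbr p b).
Local Notation T := (stack_sum nbr p b).
Local Notation st := (stacks nbr).
Local Notation okst := (is_stack nbr).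
Local Notation ub := (escape_prob nbr p b).
Local Notation qm := (exit_kernel nbr p b).
Local Notation hd := (head i0).
Local Notation Ew := (path_mean nbr qm i0).
Local Notation qw := (path_weight qm i0).

Let p0 := gw_p0 W.
Let b0 : forall i, 0 <= b i := gw_b_ge0 W.
Let Mo_ge0 n l : 0 <= M (b i0) i0 n l := stack_law_ge0 nbr p0 b0 i0 n l (b0 i0).
Let M0_ge0 i n l : 0 <= M 0 i n l := stack_law_ge0 nbr p0 b0 i n l (lexx 0).
Let qm0 : forall i j, 0 <= qm i j := exit_kernel_ge0 W.
Let qm1 : forall i, \sum_(j <- nbr i) qm i j = 1 := exit_kernel_sum W.

Lemma stack_sum_widen n m lam i g : T (m + n.+1) lam i n g = T n.+1 lam i n g.
Proof.
rewrite addnC /T big_split_ord /= [X in _ + X]big1 ?addr0 // => d _.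
rewrite big_seq big1 // => l; rewrite mem_stacks => /andP[/eqP sl _].
by rewrite stack_law_size ?mul0r // sl addSn ltnS leq_addr.
Qed.

(* Probability that the walk is pushed onto [v] at time [r.+1] and never pops
   the top of [v] afterwards. *)
Definition exit_law v r : R :=
  if v is j :: l then p (hd l) j * ub j * M (b i0) i0 r l else 0.

Lemma exit_law_ge0 v r : 0 <= exit_law v r.
Proof. by case: v => //= j l; rewrite !mulr_ge0 // (escape_prob_ge0 W). Qed.

(** Stacks of height at least [m] are written [y ++ v] with [v] of height [m] and cut at the last
    push onto [v]. Given a push at time [r.+1], the top of [v] survives until [n.+1] with
    probability at least its escape probability. The part of the mass of final exits is estimated by
    the value at [v] plus the Lipschitz cost of the remaining time; all other mass, low stacks
    included, is charged the upper bound [L]. *)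
Lemma coupling (n m : nat) (Th : seq G -> R) (C2 L : R) :
  0 <= C2 -> (0 < m)%N ->
  (forall l, 0 <= Th l) ->
  (forall y v, okst i0 (y ++ v) -> Th (y ++ v) <= Th v + C2 * (size y)%:R) ->
  (forall l, okst i0 l -> (size l <= n.+1)%N -> Th l <= L) ->
  (forall v, okst i0 v -> size v = m -> Th v + C2 * n.+1%:R <= L) ->
  T n.+2 (b i0) i0 n.+1 Th <=
    L * (1 - \sum_(v <- st i0 m) \sum_(r < n.+1) exit_law v r) +
    \sum_(v <- st i0 m) \sum_(r < n.+1) exit_law v r * (Th v + C2 * (n.+1%:R -
      r%:R)).
Proof.
move=> C20 m0 Th0 ThC ThL ThvL.
pose aw v r := if v is j :: l then p (hd l) j * M (b i0) i0 r l else 0.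
have aw0 v r : 0 <= aw v r by case: v => //= j l; rewrite mulr_ge0.
have muE v r : exit_law v r = aw v r * ub (hd v).
  by case: v => [|j l] /=; rewrite ?mul0r //; ring.
have McatE y v : size v = m ->
    M (b i0) i0 n.+1 (y ++ v) = \sum_(r < n.+1) aw v r * M 0 (hd v) (n - r) y.
  case: v => [|j l]; first by move=> m00; rewrite -m00 in m0.
  move=> _; rewrite stack_law_cat /= /conv mulr_sumr; apply: eq_bigr => r _.
  by rewrite mulrA.
(* Probability that the top of [v], pushed at time [r.+1], is still there at time [n.+1]. *)
pose U v (r : nat) := T n.+2 0 (hd v) (n - r) (fun=> 1).
have Uu v r : ub (hd v) <= U v r.
  by apply: (escape_prob_le_mass W); rewrite ltnS (leq_trans (leq_subr _ _)).
have split_T (g : seq G -> R) : T n.+2 (b i0) i0 n.+1 g =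
    \sum_(d < m) \sum_(l <- st i0 d) M (b i0) i0 n.+1 l * g l +
    \sum_(v <- st i0 m) \sum_(e < n.+2) \sum_(y <- st (hd v) e)
      M (b i0) i0 n.+1 (y ++ v) * g (y ++ v).
  rewrite -(stack_sum_widen _ m) /T big_split_ord /=; congr (_ + _).
  by rewrite exchange_big /=; apply: eq_bigr => e _; exact: sum_stacks_cat.
have upper v : okst i0 v -> size v = m ->
    \sum_(e < n.+2) \sum_(y <- st (hd v) e) M (b i0) i0 n.+1 (y ++ v) * Th (y
      ++ v)
    <= \sum_(r < n.+1) aw v r * (Th v + C2 * (n.+1%:R - r%:R)) * U v r.
  move=> okv sv.
  apply: (@le_trans _ _ (\sum_(e < n.+2) \sum_(y <- st (hd v) e) \sum_(r < n.+1)
    aw v r * M 0 (hd v) (n - r) y * (Th v + C2 * (n.+1%:R - r%:R)))).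
    apply: ler_sum => e _; rewrite big_seq [leRHS]big_seq; apply: ler_sum => y.
    rewrite mem_stacks => /andP[_ oky]; rewrite McatE // mulr_suml.
    apply: ler_sum => r _; have [sy|sy] := leqP (size y) (n - r); last first.
      by rewrite stack_law_size // mulr0 !mul0r.
    rewrite ler_wpM2l ?mulr_ge0 //.
    have oky' : okst i0 (y ++ v) by rewrite is_stack_cat oky.
    apply: le_trans (ThC _ _ oky') _; rewrite lerD2l ler_wpM2l //.
    have rn : (r <= n)%N by rewrite -ltnS.
    rewrite -natrB ?ler_nat ?leqW //; apply: leq_trans sy _.
    by rewrite leq_sub2r.
  rewrite le_eqVlt; apply/orP; left; apply/eqP.
  under eq_bigr => e _ do rewrite exchange_big /=.
  rewrite exchange_big /=; apply: eq_bigr => r _; rewrite /U /T mulr_sumr.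
  apply: eq_bigr => e _; rewrite mulr_sumr; apply: eq_bigr => y _.
  by rewrite mulr1; ring.
have mass v : size v = m ->
    \sum_(e < n.+2) \sum_(y <- st (hd v) e) M (b i0) i0 n.+1 (y ++ v) * 1
    = \sum_(r < n.+1) aw v r * U v r.
  move=> sv; rewrite /U /T.
  under [RHS]eq_bigr => r _ do rewrite mulr_sumr.
  rewrite exchange_big /=; apply: eq_bigr => e _.
  under [RHS]eq_bigr => r _ do rewrite mulr_sumr.
  rewrite exchange_big /=; apply: eq_bigr => y _.
  rewrite McatE // mulr_suml; apply: eq_bigr => r _; ring.
have total := stack_sum_mass (gw_sum W) (b i0) i0 (ltnSn n.+1).
rewrite subrr mul0r subr0 split_T in total.
pose m1 := \sum_(v <- st i0 m) \sum_(r < n.+1) aw v r * U v r.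
pose low := \sum_(d < m) \sum_(l <- st i0 d) M (b i0) i0 n.+1 l * 1.
have m1E : low + m1 = 1.
  rewrite -[RHS]total /low /m1; congr (_ + _).
  rewrite big_seq [RHS]big_seq; apply: eq_bigr => v;
    rewrite mem_stacks => /andP[/eqP sv _].
  by rewrite mass.
rewrite split_T.
have part1 : \sum_(d < m) \sum_(l <- st i0 d) M (b i0) i0 n.+1 l * Th l <=
  L * low.
  rewrite /low mulr_sumr; apply: ler_sum => d _; rewrite mulr_sumr.
  rewrite big_seq [leRHS]big_seq; apply: ler_sum => l;
    rewrite mem_stacks => /andP[_ okl].
  have [sl|sl] := leqP (size l) n.+1; last by rewrite stack_law_size // !mul0r
    mulr0.
  by rewrite mulr1 mulrC ler_wpM2r // ThL.
have part2 : \sum_(v <- st i0 m) \sum_(e < n.+2) \sum_(y <- st (hd v) e)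
      M (b i0) i0 n.+1 (y ++ v) * Th (y ++ v) <=
    L * (m1 - \sum_(v <- st i0 m) \sum_(r < n.+1) exit_law v r) +
    \sum_(v <- st i0 m) \sum_(r < n.+1) exit_law v r * (Th v + C2 * (n.+1%:R -
      r%:R)).
  rewrite /m1 -sumrB mulr_sumr -big_split /= big_seq [leRHS]big_seq.
  apply: ler_sum => v; rewrite mem_stacks => /andP[/eqP sv okv].
  apply: le_trans (upper v okv sv) _.
  rewrite -sumrB mulr_sumr -big_split /=; apply: ler_sum => r _.
  rewrite muE; set w := Th v + _.
  have wL : w <= L.
    apply: le_trans (ThvL v okv sv); rewrite lerD2l ler_wpM2l //.
    by rewrite gerBl.
  (* Survivors in excess of the true escapes are charged [L] in place of [w]. *)
  have : 0 <= (L - w) * (aw v r * (U v r - ub (hd v))).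
    by rewrite mulr_ge0 ?subr_ge0 // mulr_ge0 ?subr_ge0.
  set x := aw v r; set X := U v r; set Y := ub _; rewrite -subr_ge0 => H.
  by rewrite (_ : _ - _ = (L - w) * (x * (X - Y))) // ; ring.
apply: le_trans (lerD part1 part2) _.
by rewrite addrA -mulrDr addrA m1E.
Qed.

Lemma exit_law_moments : exists2 B : R, 0 <= B & forall v, (0 < size v)%N ->
  exists2 s, s <= B * (size v)%:R &
    has_moments (exit_law v) (qw v) (mean_exit nbr p b i0 (behead v)) s.
Proof.
have [B B0 [_ hB]] := moments_bounded W; exists B => // -[//|j l] _.
have [s sB hs] := hB l; exists s => //.
have := has_momentsZ (p (hd l) j * ub j) hs; congr has_moments.
by rewrite (exit_weight_cons W); ring.
Qed.

Lemma sum_exit_law_le v n : (0 < size v)%N -> \sum_(r < n) exit_law v r <= qw v.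
Proof.
have [B _ h] := exit_law_moments => /h[s _ [hs _ _]].
exact: sums_to_partial (exit_law_ge0 v) hs.
Qed.

Variable K : R.
Hypothesis hKK : forall n, \sum_(m < n) avoid_mass nbr qm i0 m i0 <= K.

(** Given the labels, the exit time has variance of order [m], so it stays close to its mean; up to
    bounded terms that mean is an additive functional of the exit chain, to which [path_sum_lln]
    applies. *)
Lemma time_lln : exists2 th, 1 <= th & forall e, 0 < e -> exists N, forall m,
  (N <= m)%N -> forall n,
  \sum_(v <- st i0 m.+1) \sum_(r < n) exit_law v r * `|r%:R - m.+1%:R * th| <=
    e * m.+1%:R.
Proof.
have [B B0 [mB _]] := moments_bounded W.
have [B' B0' hmu] := exit_law_moments.
pose phi (i j : G) := mean_wait nbr p b j + 1.
have phiB i j : j \in nbr i -> `|phi i j| <= B + 1.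
  by move=> _; rewrite ler_norml /phi; have /andP[? ?] := mB j; apply/andP;
    split; lra.
have [th hth] := path_sum_lln qm0 qm1 hKK phiB.
have size_le l : (size l)%:R <= path_sum i0 phi l.
  elim: l => [|j l IH] //=; rewrite -natr1 lerD // /phi lerDr.
  by have /andP[] := mB j.
(* Each level costs at least the step of its push, whence [size_le]. *)
have th1 : 1 <= th.
  rewrite -subr_le0; apply/ler_addgt0Pr => e e0; rewrite add0r.
  have [N hN] := hth e e0.
  have Np : 0 < N.+1%:R :> R by [].
  rewrite -(ler_pM2r Np); apply: le_trans (hN N.+1 (leqnSn N)).
  rewrite -[leLHS](path_mean_cst i0 qm1 N.+1); apply: le_path_mean => // l _ sl.
  apply: le_trans (ler_norm _); have := size_le l; rewrite sl; lra.
exists th => // e e0.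
pose c0 := mean (fun n => M (b i0) i0 n [::]).
have e2 : 0 < e / 4 by lra.
have [N hN] := hth _ e2.
exists (maxn N (Num.trunc ((B' / (e / 2) + `|c0| + B + 1) / (e / 4))).+1) => m.
rewrite geq_max => /andP[Nm mbig] n.
set k := m.+1; have k0 : 0 < k%:R :> R by [].
have kbig : B' / (e / 2) + `|c0| + B + 1 <= e / 4 * k%:R.
  rewrite [leRHS]mulrC -ler_pdivrMr //; apply: ltW.
  by apply: lt_le_trans (truncnS_gt _) _; rewrite ler_nat leqW.
pose t : R := e / 2 * k%:R; have t0 : 0 < t by rewrite mulr_gt0 //; lra.
apply: (@le_trans _ _ (Ew k (fun v => B' * k%:R / t / 2 + t / 2 + (`|c0| + B +
  1) +
   `|path_sum i0 phi v - k%:R * th|))).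
  rewrite /Ew big_seq [leRHS]big_seq; apply: ler_sum => v;
    rewrite mem_stacks => /andP[/eqP sv _].
  have v0 : (0 < size v)%N by rewrite sv.
  have [s sB hs] := hmu v v0; rewrite sv in sB.
  set c := mean_exit _ _ _ _ _ in hs.
  apply: (@le_trans _ _ (\sum_(r < n) exit_law v r * `|r%:R - c| +
     \sum_(r < n) exit_law v r * `|c - k%:R * th|)).
    rewrite -big_split; apply: ler_sum => r _ /=;
      rewrite -mulrDr ler_wpM2l ?exit_law_ge0 //.
    by apply: le_trans (ler_normD _ _); rewrite addrA subrK.
  apply: (@le_trans _ _ (qw v * ((s / t + t) / 2) + qw v * `|c - k%:R * th|)).
    apply: lerD; first exact: has_moments_absdev n (exit_law_ge0 v) t0 hs.
    by rewrite -mulr_suml ler_wpM2r ?sum_exit_law_le.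
  rewrite -mulrDr ler_wpM2l ?path_weight_ge0 //.
  (* [mean_exit] is taken at [behead v], so the waiting time at the top label is subtracted
     again. *)
  have cE : c = c0 + path_sum i0 phi v - phi (hd (behead v)) (hd v).
    rewrite /c /mean_exit /c0; case: (v) v0 => [//|j l] _ /=.
    rewrite addrA addrK; congr (_ + _).
    by elim: l => [|k' l IH]; rewrite ?big_nil //= big_cons IH addrC.
  have := ler_normD c0 (path_sum i0 phi v - k%:R * th).
  have := ler_normB (c0 + (path_sum i0 phi v - k%:R * th)) (phi (hd (behead v))
    (hd v)).
  have -> : c0 + (path_sum i0 phi v - k%:R * th) - phi (hd (behead v)) (hd v) =
     c - k%:R * th by rewrite cE; ring.
  have /andP[? ?] := mB (hd v).
  have : `|phi (hd (behead v)) (hd v)| <= B + 1 by rewrite ger0_norm /phi; lra.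
  have : s / t <= B' * k%:R / t by rewrite ler_pM2r ?invr_gt0.
  by lra.
rewrite path_meanD (path_mean_cst i0 qm1).
have : B' * k%:R / t / 2 <= B' / (e / 2).
  have -> : B' * k%:R / t = B' / (e / 2) by rewrite /t; field; rewrite !gt_eqF.
  have : 0 <= B' / (e / 2) by rewrite divr_ge0 //; lra.
  by lra.
have := hN k (leq_trans Nm (leqnSn m)); rewrite /t.
have : 0 < e * k%:R by rewrite mulr_gt0.
by move: kbig; set x := k%:R; set y := Ew _ _; lra.
Qed.

(** Markov's inequality: over all times the final exits have total mass 1, the sum of the path
    weights. *)
Lemma exit_law_mass_tail n m (th e : R) : m.+1%:R * th < n%:R ->
  (forall n, \sum_(v <- st i0 m.+1) \sum_(r < n) exit_law v r * `|r%:R -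
    m.+1%:R * th| <= e) ->
  1 - \sum_(v <- st i0 m.+1) \sum_(r < n) exit_law v r <=
    e / (n%:R - m.+1%:R * th).
Proof.
move=> nth hJ; set c := m.+1%:R * th; have nc : 0 < n%:R - c by rewrite
  subr_gt0.
rewrite lerBlDr.
have [B _ hmu] := exit_law_moments.
(* The guard concerns [[::]], whose [exit_law] vanishes while its path weight is 1. *)
pose f v r := if (0 < size v)%N then exit_law v r else 0.
have hs : sums_to (fun r => \sum_(v <- st i0 m.+1) f v r)
    (\sum_(v <- st i0 m.+1) if (0 < size v)%N then qw v else 0).
  apply: sums_to_big => v; rewrite /f; case: ifP => [/hmu[s _ []] //|_].
  rewrite /sums_to (_ : series _ = fun=> 0); first exact: cvg_cst.
  by apply/funext => k; rewrite series_ordE big1.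
have E1 : \sum_(v <- st i0 m.+1) (if (0 < size v)%N then qw v else 0) = 1.
  rewrite -[RHS](path_mean_cst i0 qm1 m.+1) /Ew big_seq [RHS]big_seq;
    apply: eq_bigr => v.
  by rewrite mem_stacks => /andP[/eqP -> _]; rewrite mulr1.
rewrite E1 in hs; apply: sums_to_le hs => N.
have E2 r : \sum_(v <- st i0 m.+1) f v r = \sum_(v <- st i0 m.+1) exit_law v r.
  rewrite big_seq [RHS]big_seq; apply: eq_bigr => v.
  by rewrite mem_stacks /f => /andP[/eqP -> _].
under eq_bigr => r _ do rewrite E2.
apply: (@le_trans _ _ (\sum_(r < N) \sum_(v <- st i0 m.+1)
  (exit_law v r * `|r%:R - c| / (n%:R - c) + (if (r < n)%N then exit_law v r
    else 0)))).
  apply: ler_sum => r _; apply: ler_sum => v _; case: ltnP => rn.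
    by rewrite lerDr divr_ge0 ?(ltW nc) // mulr_ge0 ?exit_law_ge0.
  rewrite addr0 -mulrA ler_peMr ?exit_law_ge0 // ler_pdivlMr // mul1r.
  apply: le_trans (ler_norm _); rewrite lerD2r ler_nat //.
rewrite exchange_big /=; under eq_bigr => v _ do rewrite big_split /=
  -mulr_suml.
rewrite big_split /= -mulr_suml; apply: lerD.
  by apply: ler_wpM2r (hJ N); rewrite invr_ge0 (ltW nc).
apply: ler_sum => v _; rewrite -big_mkcond /=.
have [Nn|nN] := leqP N n.
  rewrite (eq_bigl xpredT); last by move=> r /=;
    rewrite (leq_trans (ltn_ord r)).
  rewrite -(subnKC Nn) big_split_ord /= lerDl; apply: sumr_ge0 => r _;
    exact: exit_law_ge0.
by rewrite (big_ord_widen _ (exit_law v) (ltnW nN)).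
Qed.

End Coupling.

(** * Law of large numbers for the logarithm of the Green function *)

Section Entropy.
Variables (R : realType) (G : eqType) (nbr : G -> seq G) (p : G -> G -> R).
Variables (b : G -> R) (i0 : G) (eps z C : R).
Hypothesis W : good_walk nbr p b i0 eps z C.
Implicit Types (i j k : G) (l y v : seq G).

Local Notation T := (stack_sum nbr p b).
Local Notation st := (stacks nbr).
Local Notation okst := (is_stack nbr).
Local Notation Gf := (green_ratio nbr p b i0).
Local Notation Gb := (loop_green nbr p b).
Local Notation qm := (exit_kernel nbr p b).
Local Notation Ew := (path_mean nbr qm i0).
Local Notation mu := (exit_law nbr p b i0).

Let qm0 : forall i j, 0 <= qm i j := exit_kernel_ge0 W.
Let qm1 : forall i, \sum_(j <- nbr i) qm i j = 1 := exit_kernel_sum W.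

Definition step_cost i j : R := - ln (p i j * Gb j).

Lemma step_cost_bounded : exists2 B, 0 <= B &
  forall i j, j \in nbr i -> `|step_cost i j| <= B.
Proof.
pose Cz := (1 - z^-1)^-1; exists (`|ln eps| + `|ln Cz|);
  first by rewrite addr_ge0.
move=> i j ji; have e0 := gw_eps W; have pe := gw_p W ji.
have G1 := loop_green_ge1 W j; have p1 := gw_p_le1 W ji.
have lb : eps <= p i j * Gb j.
  by rewrite -[leLHS]mulr1 ler_pM // ltW.
have ub : p i j * Gb j <= Cz.
  apply: le_trans (loop_green_le W j); rewrite ler_piMl //; exact: le_trans G1.
have x0 : 0 < p i j * Gb j by exact: lt_le_trans lb.
have Cz0 : 0 < Cz by exact: lt_le_trans ub.
have : ln eps <= ln (p i j * Gb j) by rewrite ler_ln ?posrE.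
have : ln (p i j * Gb j) <= ln Cz by rewrite ler_ln ?posrE.
rewrite /step_cost normrN ler_norml; have := ler_norm (ln Cz).
have := ler_norm (- ln eps); rewrite normrN => ? ? ? ?.
by have := normr_ge0 (ln eps); have := normr_ge0 (ln Cz) => ? ?; apply/andP;
  split; lra.
Qed.

Lemma ln_green_ratio l : okst i0 l -> - ln (Gf l) = path_sum i0 step_cost l.
Proof.
elim: l => [|k l IH] /=; first by rewrite ln1 oppr0.
move=> /andP[kl okl]; rewrite -IH // /step_cost -opprD -mulrA lnM // posrE.
  exact: (green_ratio_gt0 W).
rewrite mulr_gt0 ?(loop_green_gt0 W) //; exact: lt_le_trans (gw_eps W) (gw_p W
  kl).
Qed.

Variable K : R.
Hypothesis hKK : forall n, \sum_(m < n) avoid_mass nbr qm i0 m i0 <= K.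

(** [coupling] is applied at a level that the walk leaves for good slightly before time [n]; the
    Lipschitz bound on the cost covers the gap. *)
Lemma green_lln :
  exists h : R, forall e, 0 < e -> exists N, forall n, (N <= n)%N ->
  T n.+2 (b i0) i0 n.+1 (fun l => `|- ln (Gf l) - n.+1%:R * h|) <= e * n.+1%:R.
Proof.
have [B B0 hB] := step_cost_bounded.
have [a ha] := path_sum_lln qm0 qm1 hKK hB.
have [th th1 hth] := time_lln W hKK.
have th0 : 0 < th by exact: lt_le_trans th1.
pose h := a / th; exists h => e e0.
have aE : a = h * th by rewrite divfK // gt_eqF.
set Bh := B + `|h|.
have Bh0 : 0 <= Bh by rewrite addr_ge0.
(* The fraction of the time left as a gap: small enough for [deB], the price of the gap, and at most
   one half. *)
pose de := e / (4 * (Bh + 1) + 2 * e).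
have den0 : 0 < 4 * (Bh + 1) + 2 * e by lra.
have de0 : 0 < de by rewrite divr_gt0.
have de2 : de <= 1 / 2 by rewrite ler_pdivrMr //; lra.
have deB : Bh * de <= e / 4.
  rewrite /de mulrA ler_pdivrMr //.
  have -> : e / 4 * (4 * (Bh + 1) + 2 * e) = Bh * e + (e + e * e / 2) by field.
  by rewrite lerDl; have := mulr_gt0 e0 e0; lra.
pose Lc := B + B + `|h|.
have Lc0 : 0 <= Lc by rewrite !addr_ge0.
(* One summand for each error proportional to [eta]: the mass not yet gone for good, the deviation
   of the cost, and that of the exit time. *)
pose fac := Lc / de + 1 + B.
have fac1 : 1 <= fac.
  have : 0 <= Lc / de by rewrite divr_ge0 // ltW.
  by rewrite /fac; lra.
pose eta := e / (4 * fac).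
have eta0 : 0 < eta by rewrite divr_gt0 //; lra.
have etafac : eta * fac = e / 4 by rewrite /eta; field; lra.
have [N1 hN1] := ha _ eta0; have [N2 hN2] := hth _ eta0.
pose N3 := (maxn N1 N2).+1.
exists (maxn (Num.trunc (4 * (Bh * th) / e)) (Num.trunc (2 * th * N3%:R))) =>
  n'.
rewrite geq_max => /andP[nb1 nb2].
set n := n'.+1.
have n1 : 4 * (Bh * th) / e <= n%:R.
  by apply: ltW; apply: lt_le_trans (truncnS_gt _) _; rewrite ler_nat /n ltnS.
have n2 : 2 * th * N3%:R <= n%:R.
  by apply: ltW; apply: lt_le_trans (truncnS_gt _) _; rewrite ler_nat /n ltnS.
have n0 : 0 < n%:R :> R by [].
(* The level is the integer part of [x]. *)
pose x := (1 - de) * n%:R / th.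
have x0 : 0 <= x by rewrite divr_ge0 ?mulr_ge0 ?(ltW th0) //; lra.
have := truncn_itv x0; case/andP; set k' := Num.trunc x => k'x xk'.
have k'N3 : (N3 <= k')%N.
  have : N3%:R <= x.
    rewrite /x ler_pdivlMr //.
    have : (1 - de - 1 / 2) * n%:R >= 0 by rewrite mulr_ge0 //; lra.
    by lra.
  by move=> /le_lt_trans/(_ xk'); rewrite ltr_nat ltnS.
case: k' k'x xk' k'N3 => [//|m] mx xm mN.
have mN1 : (N1 <= m.+1)%N by rewrite (leq_trans _ mN) // leqW // leq_maxl.
have mN2 : (N2 <= m)%N by rewrite -ltnS (leq_trans _ mN) // ltnS leq_maxr.
have kth : m.+1%:R * th <= (1 - de) * n%:R by rewrite -ler_pdivlMr.
have kth' : (1 - de) * n%:R <= m.+1%:R * th + th.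
  by have := ltW xm; rewrite /x ler_pdivrMr // -[m.+2%:R]natr1 [(m.+1%:R + 1) *
    th]mulrDl mul1r.
have mn : m.+1%:R <= n%:R :> R.
  apply: (@le_trans _ _ (m.+1%:R * th)); first by rewrite ler_peMr.
  by apply: le_trans kth _; rewrite ler_piMl //; lra.
have den : de * n%:R <= n%:R - m.+1%:R * th by lra.
have den' : n%:R - m.+1%:R * th <= de * n%:R + th by lra.
have gap0 : 0 < de * n%:R by rewrite mulr_gt0.
have hJ := hN2 _ mN2.
rewrite (@eq_stack_sum _ _ _ _ _ _ _ _ _ _ (fun l => `|path_sum i0 step_cost l
  - n%:R * h|));
  last by move=> l okl; rewrite ln_green_ratio.
have ps_cat y v : okst i0 (y ++ v) ->
    `|path_sum i0 step_cost (y ++ v) - path_sum i0 step_cost v| <=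
      B * (size y)%:R.
  elim: y => [|j y IH] /=; first by rewrite subrr normr0 mulr0.
  move=> /andP[jy /IH {}IH]; rewrite -natr1 mulrDr mulr1 addrAC.
  by apply: le_trans (ler_normD _ _) _; rewrite lerD // hB.
have ps_le v : okst i0 v -> `|path_sum i0 step_cost v| <= B * (size v)%:R.
  by move=> okv; have := ps_cat v [::]; rewrite cats0 /= subr0; apply.
have Th_le v (s : nat) : okst i0 v -> (size v <= s)%N ->
    `|path_sum i0 step_cost v - n%:R * h| <= B * s%:R + `|h| * n%:R.
  move=> okv sv; apply: le_trans (ler_normB _ _) _.
  rewrite normrM (ger0_norm (ltW n0)) [n%:R * _]mulrC lerD2r.
  by apply: le_trans (ps_le _ okv) _; apply: ler_wpM2l; rewrite // ler_nat.
have cpl := @coupling _ _ _ _ _ _ _ _ _ W n' m.+1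
  (fun l => `|path_sum i0 step_cost l - n%:R * h|) B (Lc * n%:R) B0 isT
  (fun l => normr_ge0 _).
apply: le_trans (cpl _ _ _) _.
- move=> y v ok; rewrite -lerBlDl; apply: le_trans (ps_cat y v ok).
  apply: le_trans (lerB_dist _ _) _.
  by rewrite opprB addrA subrK.
- move=> l okl sl; apply: le_trans (Th_le _ _ okl sl) _;
  rewrite -mulrDl ler_wpM2r //.
  by rewrite /Lc; lra.
- move=> v okv sv; have svn : (size v <= n)%N by rewrite sv -(ler_nat R).
  apply: le_trans (lerD (Th_le _ _ okv svn) (lexx _)) _;
    rewrite -!mulrDl ler_wpM2r //.
  by rewrite /Lc; lra.
have tail : 1 - \sum_(v <- st i0 m.+1) \sum_(r < n) mu v r <= eta / de.
  apply: le_trans (exit_law_mass_tail W (th := th) (e := eta * m.+1%:R) _ hJ) _.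
    by rewrite -subr_gt0; exact: lt_le_trans den.
  rewrite ler_pdivrMr; last exact: lt_le_trans den.
  apply: (@le_trans _ _ (eta / de * (de * n%:R))).
    by rewrite mulrA divfK ?gt_eqF // ler_wpM2l // ltW.
  by rewrite ler_wpM2l // divr_ge0 // ltW.
have Q1 : \sum_(v <- st i0 m.+1) \sum_(r < n) mu v r *
    (`|path_sum i0 step_cost v - n%:R * h| + B * (n%:R - r%:R)) <=
  Ew m.+1 (fun v => `|path_sum i0 step_cost v - m.+1%:R * a| +
    (`|h| + B) * (n%:R - m.+1%:R * th)) +
  B * \sum_(v <- st i0 m.+1) \sum_(r < n) mu v r * `|r%:R - m.+1%:R * th|.
  rewrite mulr_sumr /Ew -big_split /= big_seq [leRHS]big_seq;
    apply: ler_sum => v.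
  rewrite mem_stacks => /andP[/eqP sv okv].
  have v0 : (0 < size v)%N by rewrite sv.
  set F := `|_ - m.+1%:R * a| + _.
  have F0 : 0 <= F.
    apply: addr_ge0 => //; apply: mulr_ge0; first exact: addr_ge0.
    exact: le_trans (ltW gap0) den.
  apply: (@le_trans _ _ (\sum_(r < n) mu v r * F +
      B * \sum_(r < n) mu v r * `|r%:R - m.+1%:R * th|)); last first.
    by rewrite lerD2r -mulr_suml ler_wpM2r // (sum_exit_law_le W).
  rewrite mulr_sumr -big_split /=; apply: ler_sum => r _.
  rewrite [B * (mu v r * _)]mulrCA -mulrDr ler_wpM2l ?(exit_law_ge0 W) // /F.
  (* As [a = h * th], centring at [n * h] in place of [m.+1 * a] costs [h] times the gap. *)
  have : `|path_sum i0 step_cost v - n%:R * h| <=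
      `|path_sum i0 step_cost v - m.+1%:R * a| + `|h| * (n%:R - m.+1%:R * th).
    have -> : path_sum i0 step_cost v - n%:R * h =
      (path_sum i0 step_cost v - m.+1%:R * a) - h * (n%:R - m.+1%:R * th).
      by rewrite aE; ring.
    apply: le_trans (ler_normB _ _) _; rewrite normrM (ger0_norm (_ : 0 <=
      n%:R - _)) //.
    by apply: le_trans den; exact: ltW.
  have : B * (n%:R - r%:R) <= B * (n%:R - m.+1%:R * th) + B * `|r%:R - m.+1%:R
    * th|.
    rewrite -mulrDr ler_wpM2l //.
    have := ler_norm (- (r%:R - m.+1%:R * th)); rewrite normrN; lra.
  by rewrite mulrDl; lra.
apply: le_trans (lerD (ler_wpM2l (mulr_ge0 Lc0 (ltW n0)) tail) Q1) _.
rewrite path_meanD (path_mean_cst i0 qm1).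
have E1 := hN1 _ mN1; have E2 := ler_wpM2l B0 (hJ n).
have em : eta * m.+1%:R <= eta * n%:R by rewrite ler_wpM2l // ltW.
have Bem : B * (eta * m.+1%:R) <= B * (eta * n%:R) by rewrite ler_wpM2l.
have Bd : (`|h| + B) * (n%:R - m.+1%:R * th) <= Bh * (de * n%:R + th).
  by rewrite addrC ler_wpM2l.
have F1 : Lc * n%:R * (eta / de) + eta * n%:R + B * (eta * n%:R) = e / 4 * n%:R.
  by rewrite -etafac /fac; field; rewrite gt_eqF.
have F2 : Bh * (de * n%:R) <= e / 4 * n%:R by rewrite mulrA ler_wpM2r.
have F3 : Bh * th <= e / 4 * n%:R.
  move: n1; rewrite ler_pdivrMr //; lra.
have F4 : 0 < e * n%:R by rewrite mulr_gt0.
rewrite mulrDr in Bd.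
by move: E1 E2 em Bem Bd F1 F2 F3 F4; set y1 := Ew _ _; set y2 := _ * _; lra.
Qed.

End Entropy.

(** * Entropy and the Green function *)

Section Sandwich.
Variables (R : realType) (G : eqType) (nbr : G -> seq G) (p : G -> G -> R).
Variables (b : G -> R) (i0 : G) (eps z C : R).
Hypothesis W : good_walk nbr p b i0 eps z C.
Implicit Types (i j : G) (l y v : seq G).

Local Notation M := (stack_law nbr p b).
Local Notation T := (stack_sum nbr p b).
Local Notation st := (stacks nbr).
Local Notation okst := (is_stack nbr).
Local Notation Gf := (green_ratio nbr p b i0).
Local Notation Go := (root_green nbr p b i0).

Let p0 := gw_p0 W.
Let b0 : forall i, 0 <= b i := gw_b_ge0 W.
Let Mo_ge0 n l : 0 <= M (b i0) i0 n l := stack_law_ge0 nbr p0 b0 i0 n l (b0 i0).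

Lemma stack_law_le_green n l : M (b i0) i0 n l <= Go * Gf l.
Proof.
have := sums_to_partial n.+1 (Mo_ge0^~ l) (stack_law_sums W l).
rewrite big_ord_recr /=; apply: le_trans.
by rewrite lerDr sumr_ge0.
Qed.

Lemma ln_le_affine (B d : R) : 0 < B -> 0 < d ->
  exists c, forall x, 0 < x -> ln (B * x) <= d * x + c.
Proof.
move=> B0 d0; exists (- ln (d / B)) => x x0.
have dB : 0 < d / B by rewrite divr_gt0.
have -> : B * x = (d / B)^-1 * (d * x) by field; rewrite !gt_eqF.
have dx : 0 < d * x by rewrite mulr_gt0.
move: dB; set r := d / B => r0; rewrite lnM ?posrE ?invr_gt0 // lnV ?posrE //.
have dx0 := mulr_gt0 d0 x0.
by have := ln_sublinear dx0; lra.
Qed.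

(* Truncating the Green function of [l] at a time linear in the height loses at
   most half of it. *)
Lemma green_truncated :
  exists2 B : nat, (0 < B)%N & exists N, forall n, (N <= n)%N ->
  forall l, okst i0 l -> (size l <= n)%N ->
  Go * Gf l / 2 <= \sum_(k < B * n) M (b i0) i0 k l.
Proof.
have /andP[z1 z2] := gw_z W; have e0 := gw_eps W; have e1 := gw_eps_le1 W.
have z0 : 0 < z by exact: lt_trans z1.
have zV0 : 0 <= z^-1 by rewrite invr_ge0 ltW.
have zV1 : z^-1 <= 1 by rewrite invf_le1 // ltW.
have C1 : 1 <= C by have := gw_decay W 0; rewrite expr0 mulr1.
pose Cz := (1 - z^-1)^-1.
have Cz0 : 0 < Cz by rewrite invr_gt0 subr_gt0 invf_lt1.
(* One factor [eps] per level is lost in returning to the root and one in the lower bound for the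
   Green function; [z ^+ B] compensates for both and leaves a factor 2 per level, which finally
   beats the constant [2 * (C * Cz)]. *)
pose B := (Num.trunc (2 / eps ^+ 2 / (z - 1))).+1.
have hB : 2 / eps ^+ 2 <= z ^+ B.
  have h0 : 0 <= z - 1 by lra.
  have := bernoulli B h0; rewrite [1 + (z - 1)]addrC subrK; apply: le_trans.
  have : 2 / eps ^+ 2 < B%:R * (z - 1).
    by rewrite -ltr_pdivrMr ?subr_gt0 //; exact: truncnS_gt.
  by lra.
exists B => //; exists (Num.trunc (2 * (C * Cz))).+1 => n nN l okl sl.
have hn : 2 * (C * Cz) <= 2 ^+ n.
  have : n%:R <= 2 ^+ n :> R.
    have := @bernoulli R 1 n ler01; rewrite mulr1 (_ : 1 + 1 = 2) //; lra.
  apply: le_trans; apply: ltW; apply: lt_le_trans (truncnS_gt _) _.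
  by rewrite ler_nat.
have decay k : M (b i0) i0 k l <= C / eps ^+ n * z^-1 ^+ k.
  rewrite mulrAC ler_pdivlMr ?exprn_gt0 //.
  apply: (@le_trans _ _ (M (b i0) i0 k l * eps ^+ size l)).
    by rewrite ler_wpM2l //; apply: ler_wiXn2l => //; rewrite ltW.
  have := @stack_law_return _ _ _ _ _ _ _ _ _ W (b i0) i0 k l [::] (b0 i0).
  rewrite cats0 => /(_ okl) /le_trans; apply.
  apply: le_trans (gw_decay W _) _; apply: ler_wpM2l; first exact: le_trans C1.
  by apply: ler_wiXn2l => //; rewrite leq_addr.
have tail N : \sum_(j < N) M (b i0) i0 (B * n + j)%N l <= Go * Gf l / 2.
  apply: (@le_trans _ _ (C / eps ^+ n * z^-1 ^+ (B * n) * \sum_(j < N) z^-1 ^+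
    j)).
    rewrite mulr_sumr; apply: ler_sum => j _.
    by apply: le_trans (decay _) _; rewrite exprD mulrA.
  have D0 : 0 <= C / eps ^+ n * z^-1 ^+ (B * n).
    by rewrite !mulr_ge0 ?exprn_ge0 ?invr_ge0 ?exprn_ge0 ?(ltW e0) //; lra.
  apply: le_trans (ler_wpM2l D0 (sums_to_partial N _ (sums_to_geometric z1))) _.
    by move=> k; rewrite exprn_ge0.
  apply: (@le_trans _ _ (eps ^+ n / 2)); last first.
    rewrite ler_wpM2r //; apply: le_trans (_ : 1 * Gf l <= _).
      rewrite mul1r; apply: le_trans (green_ratio_ge W okl).
      by apply: ler_wiXn2l => //; rewrite ltW.
    by rewrite ler_wpM2r ?(green_ratio_ge0 W) ?(root_green_ge1 W).
  rewrite -/Cz.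
  have en0 : 0 < eps ^+ n by rewrite exprn_gt0.
  have zB0 : 0 < z ^+ (B * n) by rewrite exprn_gt0.
  have key : 2 ^+ n <= eps ^+ n * eps ^+ n * z ^+ (B * n).
    rewrite -exprMn_comm; last exact: mulrC.
    rewrite exprM -exprMn_comm; last exact: mulrC.
    apply: lerXn2r; rewrite ?nnegrE ?mulr_ge0 ?exprn_ge0 ?(ltW e0) ?(ltW z0) //.
    by move: hB; rewrite ler_pdivrMr ?exprn_gt0 // expr2 mulrC.
  rewrite exprVn -subr_ge0.
  rewrite (_ : _ - _ = (eps ^+ n * eps ^+ n * z ^+ (B * n) - 2 * (C * Cz)) /
     (2 * eps ^+ n * z ^+ (B * n))); last by field; rewrite !gt_eqF.
  by rewrite divr_ge0 ?subr_ge0 ?(le_trans hn) // !mulr_ge0 // ltW.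
have : Go * Gf l <= \sum_(k < B * n) M (b i0) i0 k l + Go * Gf l / 2.
  apply: sums_to_le (stack_law_sums W l) => N.
  apply: (@le_trans _ _ (\sum_(k < B * n + N) M (b i0) i0 k l)).
    rewrite addnC big_split_ord /= lerDl; exact: sumr_ge0.
  by rewrite big_split_ord /= lerD2l; exact: tail.
by lra.
Qed.

Lemma entropy_green e : 0 < e -> exists N, forall n, (N <= n)%N ->
  T n.+2 (b i0) i0 n.+1
    (fun l => `|- ln (M (b i0) i0 n.+1 l) + ln (Gf l)|) <= e * n.+1%:R.
Proof.
move=> e0; have [B B0 [N hN]] := green_truncated.
have BR0 : 0 < B%:R :> R by rewrite ltr0n.
have e2 : 0 < e / 2 by lra.
have [c hc] := ln_le_affine BR0 e2.
have Go1 := root_green_ge1 W; have Go0 := root_green_gt0 W.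
have lnGo0 : 0 <= ln Go by rewrite ln_ge0.
exists (maxn N (Num.trunc ((c + ln 2 + 2 * ln Go) / (e / 2)))) => n.
rewrite geq_max => /andP[nN nbig]; set m := n.+1.
have mN : (N <= m)%N by rewrite leqW.
have mbig : c + ln 2 + 2 * ln Go <= e / 2 * m%:R.
  rewrite [leRHS]mulrC -ler_pdivrMr //; apply: ltW.
  by apply: lt_le_trans (truncnS_gt _) _; rewrite ler_nat /m ltnS.
(* The time-averaged law: its mass is at most 1, and [green_truncated] bounds it below by the Green
   function over [2 * (B * m)]. *)
pose nu l := (B * m)%:R^-1 * \sum_(k < B * m) M (b i0) i0 k l.
have Bm0 : 0 < (B * m)%:R :> R by rewrite ltr0n muln_gt0 B0.
have nu0 l : 0 <= nu l by rewrite mulr_ge0 ?invr_ge0 ?(ltW Bm0) ?sumr_ge0.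
pose c1 := ln (B * m)%:R + ln 2 + ln Go + ln Go - 1.
have pointwise l : okst i0 l -> (size l <= m)%N ->
    M (b i0) i0 m l * `|- ln (M (b i0) i0 m l) + ln (Gf l)| <=
    M (b i0) i0 m l * c1 + nu l.
  move=> okl sl; set x := M _ _ _ _.
  have := Mo_ge0 m l; rewrite -/x le_eqVlt => /orP[/eqP <-|x0].
    by rewrite !mul0r add0r.
  have gf0 := green_ratio_gt0 W okl.
  have g0 : 0 < Go * Gf l by rewrite mulr_gt0.
  have nu_lb : Go * Gf l / 2 / (B * m)%:R <= nu l.
    by rewrite mulrC /nu ler_wpM2l ?invr_ge0 ?(ltW Bm0) ?hN.
  have nu_pos : 0 < nu l.
    by apply: lt_le_trans nu_lb; rewrite !divr_gt0.
  have L1 : ln x <= ln Go + ln (Gf l).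
    by rewrite -lnM ?posrE // ler_ln ?posrE //; exact: stack_law_le_green.
  have L2 : ln Go + ln (Gf l) - ln 2 - ln (B * m)%:R <= ln (nu l).
    rewrite -lnM ?posrE // -ln_div ?posrE // -ln_div ?posrE ?divr_gt0 //.
    by rewrite ler_ln ?posrE ?divr_gt0.
  (* Gibbs' inequality pointwise; after multiplication by [x] the term [nu l / x] sums to at most
     1. *)
  have L3 : ln (nu l) - ln x <= nu l / x - 1.
    rewrite -ln_div ?posrE //.
    have nx : 0 < nu l / x by rewrite divr_gt0.
    have := @le_ln1Dx _ (nu l / x - 1).
    by rewrite [1 + (_ - 1)]addrC subrK; apply; lra.
  have -> : x * c1 + nu l = x * (c1 + nu l / x) by field; rewrite gt_eqF.
  rewrite ler_wpM2l ?(ltW x0) //.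
  (* By [L1] the quantity is at least [- ln Go], so adding [ln Go] twice dominates its absolute
     value. *)
  have A1 : `|- ln x + ln (Gf l)| <= (- ln x + ln (Gf l) + ln Go) + ln Go.
    by rewrite ler_norml; apply/andP; split; lra.
  by apply: le_trans A1 _; rewrite /c1; lra.
have T1 : T n.+2 (b i0) i0 m (fun=> 1) = 1.
  by rewrite (stack_sum_mass (gw_sum W)) // subrr mul0r subr0.
have Tnu : \sum_(d < n.+2) \sum_(l <- st i0 d) nu l <= 1.
  have -> : \sum_(d < n.+2) \sum_(l <- st i0 d) nu l =
      (B * m)%:R^-1 * \sum_(k < B * m) T n.+2 (b i0) i0 k (fun=> 1).
    rewrite /T exchange_big mulr_sumr; apply: eq_bigr => d _.
    rewrite exchange_big mulr_sumr; apply: eq_bigr => l _ /=.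
    by congr (_ * _); apply: eq_bigr => k _; rewrite mulr1.
  rewrite mulrC ler_pdivrMr // mul1r.
  have -> : (B * m)%:R = \sum_(k < B * m) (1 : R) by rewrite sumr_const
    card_ord.
  apply: ler_sum => k _.
  apply: (@le_trans _ _ (T (n.+2 + k.+1) (b i0) i0 k (fun=> 1))).
    rewrite /T [leRHS]big_split_ord /= lerDl; apply: sumr_ge0 => d _.
    by apply: sumr_ge0 => l _; rewrite mulr1.
  rewrite (stack_sum_mass (gw_sum W)); last by rewrite addnS ltnS leq_addl.
  by rewrite subrr mul0r subr0.
apply: (@le_trans _ _ (c1 + 1)).
  apply: (@le_trans _ _ (c1 * T n.+2 (b i0) i0 m (fun=> 1) +
     \sum_(d < n.+2) \sum_(l <- st i0 d) nu l));
       last by rewrite T1 mulr1 lerD2l.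
  rewrite /T mulr_sumr -big_split; apply: ler_sum => d _ /=.
  rewrite mulr_sumr -big_split big_seq [leRHS]big_seq; apply: ler_sum => l.
  rewrite mem_stacks => /andP[/eqP sl okl] /=; rewrite mulr1 [c1 * _]mulrC.
  by apply: pointwise => //; rewrite sl -ltnS.
have := hc m%:R (ltr0Sn _ n); rewrite -natrM -/m /c1.
by have := mbig; set y := ln (B * m)%:R; lra.
Qed.

End Sandwich.

(** * Laws of Markov chains with finitely many neighbours *)

Section FiniteLaw.
Local Open Scope ereal_scope.
Variables (R : realType) (d : measure_display) (W : measurableType d).
Variable P : probability W R.

Lemma probability_setI1 (A B : set W) : measurable A -> measurable B ->
  P B = 1 -> P A = P (A `&` B).
Proof.
move=> mA mB PB; have PB0 : P (~` B) = 0 by rewrite probability_setC // PB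
  subee.
rewrite (measureDI P mA mB) -[RHS]add0e; congr (_ + _).
apply: (subset_measure0 (B := ~` B)) => //.
- exact: measurableD.
- exact: measurableC.
Qed.

Variables (U : countType) (Z : W -> U).
Hypothesis mZ : forall u, measurable [set w | Z w = u].

Lemma measurable_preimage_count (B : set U) : measurable [set w | B (Z w)].
Proof.
rewrite (_ : [set w | _] = \bigcup_(u in [set: U])
  (if `[< B u >] then [set w | Z w = u] else set0)).
  by apply: countable_bigcupT_measurable => // u; case: ifP.
apply/seteqP; split => [w /= BZ|w [u _]].
  by exists (Z w) => //; rewrite asboolT.
by case: ifP => // /asboolP Bu /= ->.
Qed.

Lemma measurable_fun_count (d' : measure_display) (V : measurableType d') (g :
  U -> V) :
  measurable_fun setT (fun w => g (Z w)).
Proof.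
by move=> _ Y mY; rewrite setTI; exact: measurable_preimage_count [set u | Y (g
  u)].
Qed.

(** Since the weights on [L] already sum to 1, [g (Z w)] agrees almost surely with a simple
    function. *)
Lemma integral_finite_law (L : seq U) (m : U -> R) (g : U -> R) : uniq L ->
  (forall u, u \in L -> P [set w | Z w = u] = (m u)%:E) ->
  (\sum_(u <- L) m u)%R = 1%R ->
  \int[P]_w (g (Z w))%:E = (\sum_(u <- L) m u * g u)%:E.
Proof.
move=> uL Pm m1.
pose h w : R := (\sum_(u <- L) g u * \1_[set w | Z w = u] w)%R.
have hE w : Z w \in L -> h w = g (Z w).
  move=> ZL; rewrite /h (bigD1_seq (Z w)) //= indicE mem_set //= mulr1 big1
    ?addr0 // => u uZ.
  rewrite indicE memNset ?mulr0 //= => e.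
  by rewrite e eqxx in uZ.
have PL : P [set w | Z w \in L] = 1.
  have -> : [set w | Z w \in L] = \big[setU/set0]_(u <- L) [set w | Z w = u].
    clear uL Pm m1 h hE; elim: L => [|u L IH]; first by rewrite big_nil;
      apply/seteqP; split.
    rewrite big_cons -IH; apply/seteqP; split => w /=; rewrite inE.
      by move=> /orP[/eqP|]; [left|right].
    by move=> [->|->]; rewrite ?eqxx ?orbT.
  have : \sum_(u <- L) P [set w | Z w = u] = 1.
    rewrite -[RHS]/((1%R : R)%:E) -m1 -sumEFin big_seq [in RHS]big_seq.
    by apply: eq_bigr => u /Pm.
  move=> <-; elim: L uL {Pm m1 h hE} => [|u L IH];
    first by rewrite !big_nil measure0.
  rewrite /= => /andP[uL /IH {}IH]; rewrite !big_cons measureU //.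
  - by congr (_ + _); exact: IH.
  - by apply: bigsetU_measurable.
  - apply/seteqP; split => // w [/= Zu].
    by rewrite -bigcup_seq => -[v /= vL Zv]; move: uL; rewrite -Zu Zv vL.
have mL : measurable [set w | Z w \in L] := measurable_preimage_count [set u |
  u \in L].
have PLC : P (~` [set w | Z w \in L]) = 0 by rewrite probability_setC // PL
  subee.
have mind u : measurable_fun setT (\1_[set w | Z w = u] : W -> R).
  exact: measurable_indic.
have int1 u : P.-integrable setT (fun w => (g u)%:E * (\1_[set w | Z w =
  u] w)%:E).
  by apply: integrableZl => //; apply: integrable_indic.
transitivity (\int[P]_w (h w)%:E).
  apply: ae_eq_integral => //.
  - by apply/measurable_EFinP; exact: measurable_fun_count.
  - apply/measurable_EFinP; apply: measurable_sum => u.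
    by apply: measurable_funM => //; exact: mind.
  - exists (~` [set w | Z w \in L]); split.
    + exact: measurableC.
    + exact: PLC.
    + move=> w /= nE ZL; apply: nE => _; rewrite hE //.
transitivity (\int[P]_w \sum_(u <- L) ((g u)%:E * (\1_[set w | Z w = u] w)%:E)).
  by apply: eq_integral => w _; rewrite /h -sumEFin.
rewrite integral_sum // -sumEFin big_seq [RHS]big_seq; apply: eq_bigr => u uL'.
rewrite integralZl //; last exact: integrable_indic.
transitivity ((g u)%:E * P [set w | Z w = u]).
  by congr (_ * _); rewrite integral_indic // setIT.
by rewrite Pm // EFinM muleC.
Qed.

End FiniteLaw.

(** * Histories of a Markov chain *)

Section Chain.
Variables (R : realType) (S : countType) (pk : S -> S -> R) (N : S -> seq S).
Variables (d : measure_display) (W : measurableType d).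
Variable P : S -> probability W R.
Variable X : nat -> W -> S.
Hypothesis hX : markov_chain pk P X.

(** Times [n] down to 1; [X 0] is left out, to match the lists of [path_mean]. *)
Fixpoint history n w : seq S :=
  if n is n'.+1 then X n w :: history n' w else [::].

Lemma measurable_state n x : measurable [set w | X n w = x].
Proof. by have [] := hX. Qed.

Lemma measurable_history n l : measurable [set w | history n w = l].
Proof.
elim: n l => [|n IH] [|y l] /=.
- by rewrite (_ : [set w | _] = setT) //; apply/seteqP; split.
- by rewrite (_ : [set w | _] = set0) //; apply/seteqP; split.
- by rewrite (_ : [set w | _] = set0) //; apply/seteqP; split.
- rewrite (_ : [set w | _] = [set w | X n.+1 w =
  y] `&` [set w | history n w = l]).
    by apply: measurableI => //; exact: measurable_state.
  by apply/seteqP; split => w /= [-> ->].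
Qed.

Lemma history_cylinder x l : exists s : nat -> S,
  (forall w, (forall k, (k <= size l)%N -> X k w = s k) <->
     (X 0%N w = x /\ history (size l) w = l)) /\ s (size l) = head x l.
Proof.
elim: l => [|y l [s [sE sl]]] /=.
  exists (fun=> x); split=> // w; split=> [h|[h _] [] //]; by split=> //;
    exact: h.
exists (fun k => if k == (size l).+1 then y else s k); split;
  last by rewrite eqxx.
move=> w; split=> [h|[X0 [Xy Xl]] k].
  have [X0 Xl] : X 0%N w = x /\ history (size l) w = l.
    apply/sE => k kl; rewrite h; last exact: leqW.
    by rewrite ltn_eqF.
  by split=> //; rewrite Xl h // eqxx.
rewrite leq_eqVlt => /orP[/eqP ->|kl]; first by rewrite eqxx.
by rewrite ltn_eqF //; apply: (proj2 (sE w)).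
Qed.

Lemma prob_start x (A : set W) : measurable A ->
  P x A = P x (A `&` [set w | X 0%N w = x]).
Proof.
move=> mA; apply: probability_setI1 => //; first exact: measurable_state.
by have [_ ->] := hX.
Qed.

Lemma prob_history x l :
  P x [set w | history (size l) w = l] = (path_weight pk x l)%:E.
Proof.
have [mX X0 Xstep] := hX.
elim: l => [|y l IH] /=.
  by rewrite (_ : [set w | _] = setT) ?probability_setT //; apply/seteqP; split.
rewrite EFinM -IH (prob_start x (measurable_history (size l) l)).
rewrite (prob_start x (measurable_history (size l).+1 (y :: l))).
have [s [sE sl]] := history_cylinder x l.
pose s' k := if k == (size l).+1 then y else s k.
have := Xstep x (size l) s'; rewrite /s' eqxx ltn_eqF // sl.
rewrite (_ : [set w | forall k, (k <= (size l).+1)%N -> _] =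
  [set w | history (size l).+1 w = y :: l] `&` [set w | X 0%N w = x]);
    last first.
  apply/seteqP; split => w /=.
    move=> h; have [] : X 0%N w = x /\ history (size l) w = l.
      apply/sE => k kl; rewrite h; last exact: leqW.
      by rewrite ltn_eqF.
    by move=> -> ->; split=> //; rewrite h // eqxx.
  move=> [[Xy Xl] Xx] k; rewrite leq_eqVlt => /orP[/eqP ->|kl];
    first by rewrite eqxx.
  by rewrite ltn_eqF //; apply: (proj2 (sE w)).
move=> ->; congr (P x _ * _)%E.
apply/seteqP; split => w /=.
  move=> h; have [] // : X 0%N w = x /\ history (size l) w = l.
  by apply/sE => k kl; rewrite h // ltn_eqF.
move=> [Xl Xx] k kl; rewrite ltn_eqF //; exact: (proj2 (sE w)).
Qed.

Hypothesis uN : forall x, uniq (N x).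

Hypothesis pk1 : forall x, \sum_(y <- N x) pk x y = 1.

Lemma integral_history x n (f : seq S -> R) :
  (\int[P x]_w (f (history n w))%:E)%E = (path_mean N pk x n f)%:E.
Proof.
rewrite (@integral_finite_law _ _ _ _ _ (history n) (measurable_history n)
  (stacks N x n)
  (path_weight pk x) f) //.
- exact: uniq_stacks.
- by move=> l; rewrite mem_stacks => /andP[/eqP <- _]; exact: prob_history.
- have := path_mean_cst x pk1 n 1; rewrite /path_mean => h; rewrite -[RHS]h.
  by apply: eq_bigr => l _; rewrite mulr1.
Qed.

(** The equivalence is required only where [X 0%N w = x], an event of probability 1. *)
Lemma prob_history_pred x n (D : set W) (F : pred (seq S)) : measurable D ->
  (forall w, X 0%N w = x -> D w <-> F (history n w)) ->
  P x D = (path_mean N pk x n (fun l => (F l)%:R))%:E.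
Proof.
move=> mD DF; pose A := [set w | F (history n w)].
have mA : measurable A.
  exact: (measurable_preimage_count (measurable_history n) [set l | F l]).
have -> : P x D = P x A.
  rewrite (prob_start x mD) (prob_start x mA); congr (P x _).
  by apply/seteqP; split => w /= [h1 h2]; split => //; apply/DF.
rewrite -integral_history; transitivity (\int[P x]_w (\1_A w)%:E)%E.
  by rewrite integral_indic // setIT.
apply: eq_integral => w _; rewrite indicE; congr (_%:R)%:E.
by rewrite /A; case: (boolP (F (history n w))) => h;
  [rewrite mem_set|rewrite memNset //; apply/negP].
Qed.

Lemma head_history x n w : X 0%N w = x -> head x (history n w) = X n w.
Proof. by case: n. Qed.

End Chain.

(** The integral of a non-negative function is a supremum over simple functions below it, hence
    monotone without measurability; this is used for [return_time]. *)
Lemma ge0_le_integral_nonmeas (R : realType) (d : measure_display)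
    (W : measurableType d) (P : probability W R) (f g : W -> \bar R) :
  (forall w, 0 <= f w)%E -> (forall w, f w <= g w)%E ->
  (\int[P]_w f w <= \int[P]_w g w)%E.
Proof.
move=> f0 fg; have g0 w : (0 <= g w)%E by exact: le_trans (fg w).
rewrite !ge0_integralTE //; apply: ereal_sup_le => _ [h hf <-].
by exists h => // w; exact: le_trans (hf w) (fg w).
Qed.

(** * Tails of the return time *)

Section ReturnTime.
Variables (R : realType) (S : countType) (q : S -> S -> R) (N : S -> seq S).
Variables (d : measure_display) (W : measurableType d).
Variable P : S -> probability W R.
Variable X : nat -> W -> S.
Hypothesis hX : markov_chain q P X.
Hypothesis uN : forall x, uniq (N x).
Hypothesis q0 : forall x y, 0 <= q x y.
Hypothesis q1 : forall x, \sum_(y <- N x) q x y = 1.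
Variable x : S.
Hypothesis hret : (\int[P x]_w return_time R X x w < +oo)%E.

Lemma path_mean_avoid n (g : S -> R) :
  path_mean N q x n (fun l => (all (fun y => y != x) l)%:R * g (head x l)) =
  iter n (avoid_op N q x) g x.
Proof.
elim: n g => [|n IH] g; first by rewrite path_mean0 /= mul1r.
rewrite path_meanS iterSr -IH; apply: eq_path_mean => l.
rewrite /avoid_op mulr_sumr [RHS]big_mkcond /=; apply: eq_bigr => y _.
by case: eqP => /= _; rewrite ?mul0r ?mulr0 //; ring.
Qed.

(** The tails [P[T > m]] sum to at most the mean return time, because pointwise the number of [m]
    before the first return is at most that return time. *)
Lemma avoid_mass_bounded :
  exists K, forall n, \sum_(m < n) avoid_mass N q x m x <= K.
Proof.
pose A m := [set w | forall k, (0 < k <= m)%N -> X k w <> x].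
have Ahist m w : A m w <-> all (fun y => y != x) (history X m w).
  elim: m => [|m IH] /=; first by split=> // _ [].
  split=> [h|/andP[/eqP h /IH Am] k /andP[k0]].
    apply/andP; split; first by apply/eqP/h; rewrite leqnn.
    by apply/IH => k /andP[k0 km]; apply: h; rewrite k0 leqW.
  rewrite leq_eqVlt => /orP[/eqP -> //|km]; by apply: Am; rewrite k0.
have mA m : measurable (A m).
  rewrite (_ : A m = [set w | all (fun y => y != x) (history X m w)]);
    last first.
    by apply/seteqP; split => w /Ahist.
  exact: (measurable_preimage_count (measurable_history hX m)
    [set l | all (fun y => y != x) l]).
have PA m : P x (A m) = (avoid_mass N q x m x)%:E.
  rewrite (prob_history_pred (x := x) hX uN q1 (mA m) (n := m)
    (F := fun l => all (fun y => y != x) l)); last by move=> w _; exact: Ahist.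
  rewrite /avoid_mass -path_mean_avoid; congr (_%:E); apply: eq_path_mean => l.
  by rewrite mulr1.
exists (fine (\int[P x]_w return_time R X x w)) => n.
have rt0 w : (0 <= return_time R X x w)%E.
  by apply: le_ereal_inf_tmp => _ [k _ <-]; rewrite lee_fin.
have count_le w : (\sum_(m < n) \1_(A m) w <= n%:R :> R) /\
    ((\sum_(m < n) (\1_(A m) w : R))%:E <= return_time R X x w)%E.
  elim: n => [|n [IH1 IH2]]; first by rewrite big_ord0.
  rewrite big_ord_recr /= -natr1; split.
    by rewrite lerD // indicE; case: (_ \in _).
  have [An|nAn] := pselect (A n w); last by rewrite indicE memNset // addr0.
  apply: le_ereal_inf_tmp => _ [k [k0 Xk] <-]; rewrite lee_fin.
  apply: (@le_trans _ _ n.+1%:R).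
    by rewrite -natr1 lerD // indicE; case: (_ \in _).
  rewrite ler_nat ltnNge; apply/negP => kn; by apply: (An k) Xk; rewrite k0.
have ir_ge0 : (0 <= \int[P x]_w return_time R X x w)%E by apply: integral_ge0.
have ifin : (\int[P x]_w return_time R X x w)%E \is a fin_num.
  by rewrite ge0_fin_numE.
rewrite -lee_fin fineK //.
apply: le_trans (ge0_le_integral_nonmeas _ (f := fun w => (\sum_(m < n) (\1_(A
  m) w : R))%:E) _ _).
- have -> : (\int[P x]_w (\sum_(m < n) (\1_(A m) w : R))%:E =
      \int[P x]_w \sum_(m < n) (\1_(A m) w)%:E)%E.
    by apply: eq_integral => w _; rewrite sumEFin.
  rewrite ge0_integral_sum //.
  + rewrite -sumEFin; apply: lee_sum => m _.
    by rewrite integral_indic // setIT -PA.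
  + by move=> m; apply/measurable_EFinP; exact: measurable_indic.
- by move=> w; rewrite lee_fin sumr_ge0.
- by move=> w; have [] := count_le w.
Qed.

End ReturnTime.

(** * The walk on the cover as a walk on stacks *)

Lemma last_rev (T : Type) (x : T) (s : seq T) : last x (rev s) = head x s.
Proof. by case: s => // y s; rewrite rev_cons last_rcons. Qed.

Section Cover.
Variables (R : realType) (G : countType) (E : rel G) (i0 : G).
Variables (pG : G -> G -> R) (b : G -> R) (nbr : G -> seq G).
Hypothesis nbrE : forall i j, (j \in nbr i) = E i j.
Hypothesis uniq_nbr : forall i, uniq (nbr i).

Local Notation p := (forward_prob pG b).
Local Notation V := (dcover E i0).
Local Notation root := (@cover_root G E i0).
Local Notation cp := (@cover_prob R G E i0 pG b).
Local Notation okst := (is_stack nbr).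
Local Notation M := (stack_law nbr p b).
Local Notation T := (stack_sum nbr p b).

Hypothesis p_sum : forall i, \sum_(j <- nbr i) p i j = 1 - b i.

Lemma path_is_stack i l : path E i (rev l) = okst i l.
Proof.
elim: l => //= k l IH; rewrite rev_cons rcons_path IH nbrE andbC.
by rewrite last_rev.
Qed.

(** Stacks list the top first and vertices the root first, hence [rev]; a list that is not a stack
    goes to the root. *)
Definition vertex (l : seq G) : V := insubd root (rev l).

Definition stack_of (x : V) : seq G := rev (val x).

Lemma is_stack_stack_of x : okst i0 (stack_of x).
Proof. by rewrite -path_is_stack /stack_of revK (valP x). Qed.

Lemma val_vertex l : okst i0 l -> val (vertex l) = rev l.
Proof. by move=> okl; rewrite /vertex val_insubd path_is_stack okl. Qed.

Lemma stack_ofK : cancel stack_of vertex.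
Proof.
by move=> x; apply: val_inj; rewrite val_vertex ?is_stack_stack_of // revK.
Qed.

Lemma vertexK l : okst i0 l -> stack_of (vertex l) = l.
Proof. by move=> okl; rewrite /stack_of val_vertex // revK. Qed.

Lemma vertex_nil : vertex [::] = root.
Proof. by apply: val_inj; rewrite val_vertex. Qed.

Lemma stack_of_root : stack_of root = [::].
Proof. by []. Qed.

Lemma label_stack_of x : label x = head i0 (stack_of x).
Proof. by rewrite /label /stack_of -{1}[val x]revK last_rev. Qed.

Lemma stack_of_parent x : stack_of (parent x) = behead (stack_of x).
Proof.
rewrite /stack_of /parent /=; case: x => s /= _; case/lastP: s => [|s j] //.
by rewrite size_rcons /= -cats1 take_size_cat // cats1 rev_rcons.
Qed.

(** The loop makes the root its own backward neighbour. *)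
Definition cover_nbr (x : V) : seq V :=
  (if x == root then root else parent x) :: [seq vertex (k :: stack_of x) | k
    <- nbr (label x)].

Lemma is_stack_child x k : k \in nbr (label x) -> okst i0 (k :: stack_of x).
Proof. by move=> kx; rewrite /= is_stack_stack_of andbT -label_stack_of. Qed.

Lemma uniq_cover_nbr x : uniq (cover_nbr x).
Proof.
rewrite /cover_nbr /=; apply/andP; split.
  apply/negP => /mapP[k kx /(congr1 (size \o stack_of)) /=].
  rewrite vertexK ?is_stack_child //=; case: eqP => _ /=; first by [].
  by rewrite stack_of_parent size_behead => /eqP;
    rewrite ltn_eqF // ltnS leq_pred.
rewrite map_inj_in_uniq // => k k' kx kx' /(congr1 stack_of).
by rewrite !vertexK ?is_stack_child // => -[].
Qed.

Lemma cover_prob_child l k :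
  okst i0 (k :: l) -> cp (vertex l) (vertex (k :: l)) = p (head i0 l) k.
Proof.
move=> okkl; have /andP[_ okl] := okkl; rewrite /cover_prob.
have -> : vertex (k :: l) != root.
  by apply/eqP => /(congr1 stack_of); rewrite vertexK // stack_of_root.
have -> : parent (vertex (k :: l)) = vertex l.
  by apply: (can_inj stack_ofK); rewrite stack_of_parent !vertexK.
by rewrite eqxx !label_stack_of !vertexK.
Qed.

Lemma cover_prob_parent l k :
  okst i0 (k :: l) -> cp (vertex (k :: l)) (vertex l) = b k.
Proof.
move=> okkl; have /andP[_ okl] := okkl; rewrite /cover_prob.
case: ifP => [/andP[_ /eqP /(congr1 (size \o stack_of))]|_] /=.
  rewrite stack_of_parent !vertexK //= size_behead => /eqP.
  by rewrite ltn_eqF // ltnS leq_pred.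
have -> : vertex (k :: l) != root.
  by apply/eqP => /(congr1 stack_of); rewrite vertexK // stack_of_root.
have -> : parent (vertex (k :: l)) = vertex l.
  by apply: (can_inj stack_ofK); rewrite stack_of_parent !vertexK.
by rewrite eqxx label_stack_of vertexK.
Qed.

Lemma cover_prob_root : cp root root = b i0.
Proof. by rewrite /cover_prob eqxx. Qed.

Lemma cover_step (g : V -> R) l : okst i0 l ->
  kernel_op cover_nbr cp g (vertex l) = \sum_(k <- nbr (head i0 l)) p (head i0
    l) k * g (vertex (k :: l)) +
  (if l is k :: l' then b k * g (vertex l') else b i0 * g root).
Proof.
move=> okl; rewrite /kernel_op /cover_nbr big_cons addrC; congr (_ + _).
  rewrite big_map label_stack_of vertexK // big_seq [RHS]big_seq;
    apply: eq_bigr => k kl.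
  by rewrite cover_prob_child //= kl.
case: l okl => [|k l] okl; first by rewrite vertex_nil eqxx cover_prob_root.
have -> : vertex (k :: l) == root = false.
  by apply/eqP => /(congr1 stack_of); rewrite vertexK // stack_of_root.
have -> : parent (vertex (k :: l)) = vertex l.
  have /andP[_ okl'] := okl.
  by apply: (can_inj stack_ofK); rewrite stack_of_parent !vertexK.
by rewrite cover_prob_parent.
Qed.

Lemma cover_prob_sum x : \sum_(y <- cover_nbr x) cp x y = 1.
Proof.
have := cover_step (fun=> 1) (is_stack_stack_of x);
  rewrite stack_ofK /kernel_op.
under eq_bigr do rewrite mulr1; move=> ->.
under eq_bigr do rewrite mulr1; rewrite p_sum.
by case: (stack_of x) => [|k l] /=; rewrite mulr1 subrK.
Qed.

Variables (d : measure_display) (W : measurableType d) (P : V ->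
  probability W R).
Variable X : nat -> W -> V.
Hypothesis hX : markov_chain cp P X.

(** Induction on [n] moves the last step into [g]; by [cover_step] the kernel of the cover is
    [stack_step] with [lam = b i0]. *)
Lemma path_mean_stack_sum n D (g : V -> R) : (n < D)%N ->
  path_mean cover_nbr cp root n (fun h => g (head root h)) =
    T D (b i0) i0 n (g \o vertex).
Proof.
elim: n g => [|n IH] g nD; first by rewrite path_mean0 stack_sum0 //=
  vertex_nil.
rewrite stack_sumS //.
transitivity (path_mean cover_nbr cp root n (fun h => kernel_op cover_nbr cp g
  (head root h))).
  exact: (path_mean_kernel_op cover_nbr cp root n g).
rewrite (IH _ (ltnW nD)).
by apply: eq_stack_sum => l okl /=; rewrite cover_step // /stack_step
  -vertex_nil.
Qed.

Lemma integral_state n (g : V -> R) :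
  (\int[P root]_w (g (X n w))%:E)%E = (T n.+1 (b i0) i0 n (g \o vertex))%:E.
Proof.
rewrite -path_mean_stack_sum // -(integral_history hX uniq_cover_nbr
  cover_prob_sum).
have mX : forall n x, measurable [set w | X n w = x] := measurable_state hX.
apply: ae_eq_integral => //.
- by apply/measurable_EFinP; exact: (measurable_fun_count (mX n) g).
- apply/measurable_EFinP.
  exact: (measurable_fun_count (measurable_history hX n) (fun h => g (head root
    h))).
exists (~` [set w | X 0%N w = root]); split.
- by apply: measurableC; exact: mX.
- have PC : P root (~` [set w | X 0%N w = root]) = 0%E.
    have [_ X0 _] := hX; rewrite probability_setC; last exact: mX.
    by rewrite X0 subee.
  exact: PC.
- by move=> w /= nE X0; apply: nE => _; rewrite head_history.
Qed.

Lemma stack_sum_delta D lam i n l : okst i l -> (size l < D)%N ->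
  T D lam i n (fun l' => (l' == l)%:R) = M lam i n l.
Proof.
move=> okl sl; rewrite /T (bigD1 (Ordinal sl)) //= (bigD1_seq l) ?uniq_stacks
  //=; last first.
  by rewrite mem_stacks eqxx.
rewrite eqxx mulr1 big1 => [|l' /negPf ->]; last by rewrite mulr0.
rewrite addr0 big1 ?addr0 // => e el; rewrite big_seq big1 // => l'.
rewrite mem_stacks => /andP[/eqP sl' _]; case: eqP => [e'|_];
  last by rewrite mulr0.
by move: el; rewrite -val_eqE /= -sl' e' eqxx.
Qed.

Lemma law_stack_law n x : law P X root n x = M (b i0) i0 n (stack_of x).
Proof.
have [X0 _] : (forall w, X 0%N w = root ->
    X n w = x <-> head root (history X n w) == x) /\ True.
  split=> // w X0; rewrite head_history //; split=> [->|/eqP //]; exact: eqxx.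
rewrite /law (prob_history_pred hX uniq_cover_nbr cover_prob_sum _ (n := n)
  (F := fun h => head root h == x)) //=; last exact: measurable_state hX n x.
rewrite (path_mean_stack_sum (D := n.+1 + (size (stack_of x)).+1) (fun y => (y
  == x)%:R)); last first.
  by rewrite addSn ltnS leq_addr.
rewrite -(stack_sum_delta (D := n.+1 + (size (stack_of x)).+1))
  ?is_stack_stack_of //; last by rewrite addnS ltnS leq_addl.
apply: eq_stack_sum => l okl /=; suff -> : (vertex l == x) =
  (l == stack_of x) by [].
by apply/eqP/eqP => [<-|->]; rewrite ?vertexK ?stack_ofK.
Qed.

(** * The walk in a cone until it reaches the parent of the apex *)

Section Taboo.
Variables (i : G) (l0 : seq G).
Hypothesis okl0 : okst i0 (i :: l0).

Local Notation x := (vertex (i :: l0)).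
Local Notation z0 := (vertex l0).

(** Constrains the states at all times before the last one; the default [x] of [head] stands for
    time 0. *)
Fixpoint avoid (h : seq V) : bool :=
  if h is _ :: h' then (head x h' != z0) && avoid h' else true.

Lemma avoid_history n w : X 0%N w = x ->
  avoid (history X n w) <-> forall m, (m < n)%N -> X m w <> z0.
Proof.
move=> X0; elim: n => [|n IH] /=; first by split.
rewrite head_history //; split=> [/andP[/eqP Xn /IH h] m|h].
  by rewrite ltnS leq_eqVlt => /orP[/eqP -> //|]; exact: h.
apply/andP; split; first by apply/eqP; exact: h.
by apply/IH => m mn; apply: h; exact: ltnW.
Qed.

Let okz0 : okst i0 l0.
Proof. by have /andP[] := okl0. Qed.

Let ok_cat l : okst i l -> okst i0 (l ++ i :: l0).
Proof. by move=> okl; rewrite is_stack_cat okl. Qed.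

Let dec_cat_neq l : okst i l -> vertex (l ++ i :: l0) != z0.
Proof.
move=> okl; apply/eqP => /(congr1 (size \o stack_of)) /=;
  rewrite !vertexK ?ok_cat //.
by rewrite size_cat /= => /eqP; rewrite gtn_eqF // addnS ltnS leq_addl.
Qed.

(** Either the walk is still in the cone, where it is the stack walk with [lam = 0], or it steps
    onto the parent exactly at time [n], after a loop of length [n - 1]. *)
Lemma path_mean_taboo n D (g : V -> R) : (n < D)%N ->
  path_mean cover_nbr cp x n (fun h => (avoid h)%:R * g (head x h)) =
  T D 0 i n (fun l => g (vertex (l ++ i :: l0))) +
  (if n is m.+1 then b i * loop_law nbr p b i m else 0) * g z0.
Proof.
elim: n g => [|n IH] g nD; first by rewrite path_mean0 stack_sum0 // mul0r
  addr0 mul1r.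
rewrite path_meanS.
rewrite (@eq_path_mean _ _ _ _ _ _ _ (fun h => (avoid h)%:R *
    ((head x h != z0)%:R * kernel_op cover_nbr cp g (head x h)))); last first.
  move=> h; rewrite mulrA -natrM mulnb andbC /kernel_op mulr_sumr.
  by apply: eq_bigr => y _ /=; rewrite mulrCA.
etransitivity; first exact: (IH (fun y => (y != z0)%:R * kernel_op cover_nbr cp
  g y) (ltnW nD)).
rewrite /= eqxx mul0r mulr0 addr0 (stack_sumS _ _ _ _ _ _ nD).
rewrite (@eq_stack_sum _ _ _ _ _ _ _ _ _ _ (fun l => stack_step nbr p b 0 i
    (fun l => g (vertex (l ++ i :: l0))) l + (b i * g z0) * (l == [::])%:R)).
  by rewrite stack_sumD stack_sumZ (stack_sum_nil _ _ _ _ _ _ (leq_ltn_trans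
    (leq0n _) nD)) mulrAC.
move=> l okl; rewrite dec_cat_neq // mul1r cover_step ?ok_cat // /stack_step.
have -> : head i0 (l ++ i :: l0) = head i l by case: l {okl}.
by case: l okl => [|k l] okl /=; [rewrite mul0r addr0 mulr1|rewrite mulr0
  addr0].
Qed.

Lemma measurable_taboo n y :
  measurable [set w | X n w = y /\ forall m, (m < n)%N -> X m w <> z0].
Proof.
rewrite (_ : [set w | _] = [set w | X n w = y] `&`
    \bigcap_(m in [set m | (m < n)%N]) ~` [set w | X m w = z0]).
  apply: measurableI; first exact: measurable_state hX n y.
  apply: bigcap_measurableType => m _.
  by apply: measurableC; exact: measurable_state hX m z0.
by apply/seteqP; split => w /=.
Qed.

Lemma prob_taboo n y :
  P x [set w | X n w = y /\ forall m, (m < n)%N -> X m w <> z0] =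
  (path_mean cover_nbr cp x n (fun h => (avoid h)%:R * (head x h == y)%:R))%:E.
Proof.
rewrite (prob_history_pred (x := x) hX uniq_cover_nbr cover_prob_sum
  (measurable_taboo n y) (n := n)
  (F := fun h => avoid h && (head x h == y))).
  by congr (_%:E); apply: eq_path_mean => h; rewrite -natrM mulnb.
move=> w X0 /=; rewrite head_history //; split=> [[-> h]|/andP[h /eqP ->]].
  by apply/andP; split=> //; apply/avoid_history.
by split=> //; apply/avoid_history.
Qed.

Lemma prob_return n :
  P x [set w | X n w = x /\ forall m, (m < n)%N ->
    X m w <> z0] = (loop_law nbr p b i n)%:E.
Proof.
rewrite prob_taboo (path_mean_taboo (D := n.+1) (fun y => (y == x)%:R)) //.
have -> : (z0 == x) = false by rewrite eq_sym;
  apply/negbTE/(dec_cat_neq (l := [::])).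
rewrite mulr0 addr0 -[loop_law _ _ _ _ _]/(M 0 i n [::]) -(stack_sum_nil nbr p
  b 0 i n (ltn0Sn n)); congr (_%:E).
apply: eq_stack_sum => l okl; case: l okl => [|k l] okl; first by rewrite !eqxx.
suff -> : (vertex ((k :: l) ++ i :: l0) == x) = false by [].
apply/eqP => /(congr1 (size \o stack_of)) /=; rewrite !vertexK ?(ok_cat (l := k
  :: l)) //=.
by rewrite size_cat /= => /eqP; rewrite gtn_eqF // addnS !ltnS leq_addl.
Qed.

Lemma prob_hit n :
  P x [set w | X n w = z0 /\ forall m, (m < n)%N -> X m w <> z0] =
  (shift (fun m => b i * loop_law nbr p b i m) n)%:E.
Proof.
rewrite prob_taboo (path_mean_taboo (D := n.+1) (fun y => (y == z0)%:R)) //.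
rewrite eqxx mulr1 (@eq_stack_sum _ _ _ _ _ _ _ _ _ _ (fun l => 0 * 1)).
  by rewrite stack_sumZ mul0r add0r.
by move=> l okl; rewrite (negPf (dec_cat_neq okl)) mul0r.
Qed.

End Taboo.

End Cover.

(** * Finite lists of successors *)

Section OutNeighbours.
Variables (R : realType) (G : countType) (E : rel G).
Hypothesis hgeom : bounded_geometry E.

Definition out_nbr (i : G) : seq G :=
  finmap.enum_fset (fset_set [set j | E i j]).

Lemma finite_out i : finite_set [set j | E i j].
Proof.
by have [D hD] := hgeom; apply: card_le_finite (hD i) _; exact: finite_II.
Qed.

Lemma out_nbrE i j : (j \in out_nbr i) = E i j.
Proof.
have -> : (j \in out_nbr i) = (j \in [set j | E i j]).
  exact: in_fset_set (finite_out i) j.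
by apply/idP/idP; rewrite inE.
Qed.

Lemma uniq_out_nbr i : uniq (out_nbr i).
Proof. exact: finmap.fset_uniq. Qed.

Lemma sum_out_nbr (pG : G -> G -> R) (b : G -> R) i : transition_data E pG b ->
  \sum_(j <- out_nbr i) forward_prob pG b i j = 1 - b i.
Proof.
move=> [pG0 pG1 pGE _]; rewrite /forward_prob -mulr_sumr.
suff -> : \sum_(j <- out_nbr i) pG i j = 1 by rewrite mulr1.
apply: EFin_inj; rewrite -(pG1 i) (esumID [set j | E i j]) //=; last first.
  by move=> j _; rewrite lee_fin.
rewrite setTI [X in (_ + X)%E]esum1 ?adde0; last first.
  move=> j [_ /= /negP nE]; have := pG0 i j; rewrite le_eqVlt => /orP[/eqP <-
    //|].
  by move=> /pGE; rewrite (negPf nE).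
rewrite esum_fset; last 2 first.
- exact: finite_out.
- by move=> j _; rewrite lee_fin.
by rewrite fsbig_finite ?sumEFin //; exact: finite_out.
Qed.

Lemma stack_of_path i s : path E i s -> is_stack out_nbr i (rev s) /\
  head i (rev s) = last i s.
Proof.
move=> ps; rewrite -(path_is_stack out_nbrE) revK ps; split=> //.
by rewrite -last_rev revK.
Qed.

End OutNeighbours.

Lemma sums_to_nneseries (R : realType) (f : nat -> R) (s : R) :
  sums_to f s -> (\sum_(0 <= n <oo) (f n)%:E = s%:E)%E.
Proof.
move=> fs; have fcv : cvgn (series f) := cvgP _ fs.
rewrite -(cvg_lim (@Rhausdorff R) fs) -EFin_lim //; congr (limn _).
by apply/funext => n /=; rewrite sumEFin.
Qed.

(** * Identification of $F(-i)$, $\overline{G}_i(1)$ and $Q$ *)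

Section Identification.
Variables (R : realType) (G : countType) (E : rel G) (i0 : G).
Variables (pG : G -> G -> R) (b : G -> R) (nbr : G -> seq G).
Hypothesis nbrE : forall i j, (j \in nbr i) = E i j.
Hypothesis uniq_nbr : forall i, uniq (nbr i).
Local Notation p := (forward_prob pG b).
Variables (eps z C : R).
Hypothesis Wk : good_walk nbr p b i0 eps z C.
Variables (d : measure_display) (W : measurableType d).
Variables (P : dcover E i0 -> probability W R) (X : nat -> W -> dcover E i0).
Hypothesis hX : markov_chain (cover_prob pG b) P X.

Lemma vertex_of_stack i : exists2 l, is_stack nbr i0 (i :: l) &
  vertex_of E i0 i = vertex E i0 (i :: l) /\ parent (vertex_of E i0 i) =
    vertex E i0 l.
Proof.
have [l okl] := gw_reach Wk i.
have : vertex_of E i0 i <> cover_root /\ label (vertex_of E i0 i) = i.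
  rewrite /vertex_of; case: xgetP => [x _ //|/(_ (vertex E i0 (i :: l))) []];
    split.
    by move/(congr1 (fun x => stack_of x)); rewrite (vertexK nbrE).
  by rewrite label_stack_of (vertexK nbrE).
set x := vertex_of E i0 i => -[xr lx].
case sx : (stack_of x) => [|j l'].
  by case: xr; rewrite -[x](stack_ofK nbrE) sx (vertex_nil _ nbrE).
have ji : j = i by rewrite -lx label_stack_of sx.
exists l'; first by rewrite -ji -sx; exact: is_stack_stack_of.
by rewrite -ji -sx (stack_ofK nbrE) -[parent x](stack_ofK nbrE) stack_of_parent
  sx.
Qed.

Lemma G_barE i : G_bar P X i = loop_green nbr p b i.
Proof.
have [l okl [xE zE]] := vertex_of_stack i; rewrite /G_bar zE xE.
rewrite (eq_eseriesr (g := fun n => (loop_law nbr p b i n)%:E)).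
  by rewrite (sums_to_nneseries (loop_green_sums Wk i)).
by move=> n _; rewrite (prob_return nbrE uniq_nbr (gw_sum Wk) hX okl).
Qed.

(** The hitting event is the disjoint union over the first hitting times, whose probabilities are
    given by [prob_hit]. *)
Lemma F_backE i : F_back P X i = fall_prob nbr p b i.
Proof.
have [l okl [xE zE]] := vertex_of_stack i; rewrite /F_back zE xE.
pose F n := [set w | X n w = vertex E i0 l /\ forall m,
  (m < n)%N -> X m w <> vertex E i0 l].
have mF n : measurable (F n) by exact: measurable_taboo hX l n _.
rewrite (_ : [set w | _] = \bigcup_n F n); last first.
  apply/seteqP; split=> [w [n Xn]|w [n _ [Xn _]]]; last by exists n.
  have ex : exists n, X n w == vertex E i0 l by exists n; exact/eqP.
  exists (ex_minn ex) => //; case: ex_minnP => m /eqP Xm mmin;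
    split=> // k km Xk.
  by have := mmin k; rewrite Xk eqxx => /(_ isT); rewrite leqNgt km.
rewrite measure_semi_bigcup //=; first last.
- exact: bigcupT_measurable.
- apply/trivIsetP => m n _ _ mn; apply/seteqP; split=> // w [[Xm hm] [Xn hn]].
  by case: (ltngtP m n) mn => // [/hn|/hm].
rewrite (eq_eseriesr (g := fun n => (shift (fun m => b i * loop_law nbr p b i
  m) n)%:E)).
  by rewrite (sums_to_nneseries (sums_to_shift (sums_toZ (b i) (loop_green_sums
    Wk i)))).
by move=> n _; rewrite (prob_hit nbrE uniq_nbr (gw_sum Wk) hX okl).
Qed.

Lemma Q_matrixE : Q_matrix pG b P X = exit_kernel nbr p b.
Proof.
by apply/funext => i; apply/funext => j; rewrite /Q_matrix !F_backE G_barE.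
Qed.

End Identification.

(** * From the spectral radius to decay, and convergence in L1 *)

Lemma spectral_decay (R : realType) (a : nat -> R) : (forall n, 0 <= a n) ->
  ((convergence_radius a)^-1 < 1)%E ->
  exists z C : R, 1 < z <= 2 /\ forall n, a n <= C * z^-1 ^+ n.
Proof.
move=> a0 hr.
have [z z1 [z0 zcv]] : exists2 z : R, 1 < z & 0 <=
  z /\ cvgn (series (fun n => a n * z ^+ n)).
  apply: contrapT => nz.
  have r1 : (convergence_radius a <= 1)%E.
    apply: ge_ereal_sup => _ [z [z0 zcv] <-]; rewrite lee_fin leNgt.
    by apply/negP => z1; apply: nz; exists z.
  (* A radius in [[0, 1]] has an inverse at least 1, with [+oo] for the inverse of 0; the lower
     bound excludes negative inverses. *)
  have r0 : (0 <= convergence_radius a)%E.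
    apply: ereal_sup_ubound; exists 0 => //; split=> //.
    have : sums_to (fun n => a n * 0 ^+ n) (a 0%N * 0 ^+ 0 + 0).
      apply: (@sums_to_recl _ _ (fun=> 0)) => [n|];
        first by rewrite expr0n mulr0.
      rewrite /sums_to (_ : series _ = fun=> 0); first exact: cvg_cst.
      by apply/funext => n; rewrite series_ordE big1.
    by move=> /cvgP.
  move: hr; case: inveP r0 r1 => // r rn0; rewrite !lee_fin lte_fin => r0 r1.
  have rp : 0 < r by rewrite lt_def rn0.
  by rewrite invf_lt1 // ltNge r1.
have t0 n : 0 <= a n * z ^+ n by rewrite mulr_ge0 // exprn_ge0.
pose S := limn (series (fun n => a n * z ^+ n)).
have hS : sums_to (fun n => a n * z ^+ n) S by [].
have z2 : 0 < Num.min z 2 by rewrite lt_min; apply/andP; split => //;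
  exact: lt_trans z1.
exists (Num.min z 2), S; split; first by rewrite lt_min z1 ge_min lexx orbT
  ltr1n.
move=> n; rewrite exprVn ler_pdivlMr ?exprn_gt0 //.
apply: (@le_trans _ _ (a n * z ^+ n)).
  rewrite ler_wpM2l // lerXn2r ?nnegrE ?(ltW z2) //.
  by rewrite ge_min lexx.
by apply: le_trans (sums_to_partial n.+1 t0 hS);
  rewrite big_ord_recr /= lerDr sumr_ge0.
Qed.

Lemma cover_good_walk (R : realType) (G : countType) (E : rel G) (i0 : G)
  (hconn : strongly_connected E) (hgeom : bounded_geometry E)
  (pG : G -> G -> R) (b : G -> R) (hdata : transition_data E pG b)
  (d : measure_display) (W : measurableType d)
  (P : dcover E i0 -> probability W R) (X : nat -> W -> dcover E i0)
  (hX : markov_chain (cover_prob pG b) P X)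
  (hbound : exists eps0 : R, 0 < eps0 /\
    forall x y : dcover E i0,
      0 < cover_prob pG b x y -> eps0 <= cover_prob pG b x y)
  (hrho : (spectral_radius P X < 1)%E) :
  exists eps z C : R, good_walk (out_nbr E) (forward_prob pG b) b i0 eps z C.
Proof.
have nbrE := out_nbrE hgeom; have p_sum i := sum_out_nbr hgeom i hdata.
have [pG0 pG1 pGE [e1 [/andP[e10 e11] hb]]] := hdata.
have [e2 [e20 he2]] := hbound.
have b1 i : 0 < 1 - b i by have /andP[_] := hb i; lra.
have p0 i j : 0 <= forward_prob pG b i j.
  by rewrite mulr_ge0 // ltW.
have b0 i : 0 <= b i by have /andP[] := hb i; lra.
have conn i j : exists l, is_stack (out_nbr E) i l /\ head i l = j.
  have [s [ps <-]] := hconn i j; exists (rev s).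
  exact: (stack_of_path hgeom).
have reach i : exists l, is_stack (out_nbr E) i0 (i :: l).
  (* A first step away from [i0] is forced, so that the stack is non-empty even for [i = i0]. *)
  have [j ji0 _] : exists2 j, j \in out_nbr E i0 & 0 < forward_prob pG b i0 j.
    by apply: sum_gt0_mem => [j|]; [exact: p0|rewrite p_sum].
  have [s [ps sl]] := hconn j i.
  have pjs : path E i0 (j :: s) by rewrite /= ps -nbrE ji0.
  have [okl hl] := stack_of_path hgeom pjs.
  move: okl hl; rewrite /= sl; case: (rev (j :: s)) (size_rev (j :: s)) => // k
    l _.
  by move=> okl /= <-; exists l.
have M0 n : 0 <= stack_law (out_nbr E) (forward_prob pG b) b (b i0) i0 n [::].
  by apply: stack_law_ge0.
have lawE : (fun n => law P X cover_root n cover_root) =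
    (fun n => stack_law (out_nbr E) (forward_prob pG b) b (b i0) i0 n [::]).
  by apply/funext => n; rewrite (law_stack_law nbrE (uniq_out_nbr E) p_sum hX).
move: hrho; rewrite /spectral_radius lawE => /(spectral_decay M0)[z [C [hz
  hC]]].
(* [e1] bounds the backward probabilities, [e2] the forward ones. *)
exists (Num.min e1 e2), z, C; split => //.
- exact: uniq_out_nbr.
- by rewrite lt_min e10.
- by move=> i; rewrite ge_min; have /andP[/ltW -> _] := hb i.
- move=> i j ij; rewrite ge_min; apply/orP; right.
  have [l okl] := reach i.
  have okjl : is_stack (out_nbr E) i0 [:: j, i & l] by rewrite /= ij.
  have := he2 (vertex E i0 (i :: l)) (vertex E i0 [:: j, i & l]).
  rewrite (cover_prob_child _ _ nbrE okjl) /=; apply.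
  by rewrite mulr_gt0 //; apply/pGE; rewrite -nbrE.
Qed.

Theorem theorem3p11 (R : realType) (G : countType) (E : rel G) (i0 : G)
  (hconn : strongly_connected E) (hgeom : bounded_geometry E)
  (pG : G -> G -> R) (b : G -> R) (hdata : transition_data E pG b)
  (d : measure_display) (W : measurableType d)
  (P : dcover E i0 -> probability W R) (X : nat -> W -> dcover E i0)
  (hX : markov_chain (cover_prob pG b) P X)
  (htrans : transient P X)
  (hbound : exists eps0 : R, 0 < eps0 /\
    forall x y : dcover E i0,
      0 < cover_prob pG b x y -> eps0 <= cover_prob pG b x y)
  (hQ : positive_recurrent (Q_matrix pG b P X))
  (hrho : (spectral_radius P X < 1)%E) :
  exists h : R,
    (fun n : nat =>
      (- ((n%:R^-1)%:E *
          'E_(P cover_root)[fun w => ln (law P X cover_root n (X n w))]))%E) @ \oo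
      --> h%:E /\
    (fun n : nat =>
      (\int[P cover_root]_w
        `| - (n%:R^-1 * ln (law P X cover_root n (X n w))) - h |%:E)%E) @ \oo
      --> 0%E.
Proof.
have nbrE := out_nbrE hgeom; have p_sum i := sum_out_nbr hgeom i hdata.
have uN := @uniq_out_nbr G E.
have [eps [z [C Wk]]] := cover_good_walk hconn hgeom hdata hX hbound hrho.
move: hQ; rewrite (Q_matrixE nbrE uN Wk hX) => -[d' [W' [P' [X' [hX' hret]]]]].
have [K hKK] := avoid_mass_bounded hX' uN (exit_kernel_sum Wk) (hret i0).
have [h hh] := green_lln Wk hKK.
have lawE n x := law_stack_law nbrE uN p_sum hX n x.
pose T' n g := stack_sum (out_nbr E) (forward_prob pG b) b n.+1 (b i0) i0 n g.
pose g n x : R := - (n%:R^-1 * ln (law P X cover_root n x)) - h.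
have p0 := gw_p0 Wk; have b0 i : 0 <= b i := gw_b_ge0 Wk i.
have T1 n : T' n (fun=> 1) = 1.
  by rewrite /T' (stack_sum_mass p_sum) // subrr mul0r subr0.
have Tabs n f : `|T' n f| <= T' n (fun l => `|f l|).
  apply: le_trans (ler_norm_sum _ _ _) _; apply: ler_sum => e _.
  apply: le_trans (ler_norm_sum _ _ _) _; apply: ler_sum => l _.
  by rewrite normrM ger0_norm // stack_law_ge0.
(* The L1 distance of the conclusion, written as a finite sum. *)
pose u n := T' n (fun l => `|g n (vertex E i0 l)|).
have u0 : u @ \oo --> 0.
  apply/cvgrPdist_le => e e0; have e2 : 0 < e / 2 by lra.
  have [N1 hN1] := hh _ e2; have [N2 hN2] := entropy_green Wk e2.
  exists (maxn N1 N2).+1 => // -[//|n] /=; rewrite ltnS geq_max => /andP[n1 n2].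
  have np : 0 < n.+1%:R :> R by [].
  have un0 : 0 <= u n.+1.
    exact: le_trans (normr_ge0 _) (Tabs _ (fun l => g n.+1 (vertex E i0 l))).
  rewrite sub0r normrN ger0_norm //.
  rewrite -(ler_pM2l np) /u /T' -stack_sumZ.
  (* The logarithm of the Green function is inserted between the logarithm of the law and its
     limit. *)
  apply: le_trans (_ : _ <= e / 2 * n.+1%:R + e / 2 * n.+1%:R) _; last by lra.
  apply: le_trans (lerD (hN2 n n2) (hN1 n n1)); rewrite -stack_sumD.
  apply: le_stack_sum => // l okl _.
  rewrite /g lawE (vertexK nbrE okl) -[X in X * `|_|]ger0_norm // -normrM.
  apply: le_trans (ler_normD _ _); rewrite le_eqVlt; apply/orP; left; apply/eqP.
  by congr `|_|; field; rewrite gt_eqF.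
exists h; split; last first.
  have IE n := integral_state nbrE uN p_sum hX n (fun x => `|g n x|).
  apply: cvg_EFin; first by near=> n; rewrite IE.
  by rewrite (_ : fine \o _ = u) //; apply/funext => n /=; rewrite IE.
have EE n : (- ((n%:R^-1)%:E *
    'E_(P cover_root)[fun w => ln (law P X cover_root n (X n w))]) =
    (T' n (fun l => g n (vertex E i0 l)) + h)%:E)%E.
  rewrite unlock (integral_state nbrE uN p_sum hX n
    (fun x => ln (law P X cover_root n x))) -EFinM -EFinN; congr (_%:E).
  have hT : h = h * T' n (fun=> 1) by rewrite T1 mulr1.
  rewrite [X in _ = _ + X]hT /T' -!stack_sumZ -stack_sumD -mulN1r -stack_sumZ.
  by apply: eq_stack_sum => l _; rewrite /g /=; ring.
apply: cvg_EFin; first by near=> n; rewrite EE.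
rewrite (_ : fine \o _ = fun n => T' n (fun l => g n (vertex E i0 l)) + h);
  last by apply/funext => n /=; rewrite EE.
suff H : (fun n => T' n (fun l => g n (vertex E i0 l))) @ \oo --> 0.
  by rewrite -[X in _ --> X]add0r; apply: cvgD => //; exact: cvg_cst.
(* The signed mean error is dominated by [u]. *)
apply/norm_cvg0P; apply: (squeeze_cvgr _ (cvg_cst 0) u0).
by near=> n; rewrite normr_ge0 /=; exact: Tabs.
Unshelve. all: end_near. Qed.
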